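(* There is an absolute constant $C>0$ such that the following holds. Let $A:\mathcal F\to\mathcal F$ be a mapping and let $k$ be a nonnegative integer. Let $r\ge 2$ and suppose that $$\|A[f]\|_{\psi_{2,r+k}}\le\|f\|_{\psi_{2,r+k}}\quad\text{for all } f\in\mathcal F,\qquad\text{and}\qquad |A[\mathcal F]|\le e^{k},$$ where $A[\mathcal F]=\{A[f]: f\in\mathcal F\}$ is the range of $A$. Let $$\mathcal A=\{f-A[f]: f\in\mathcal F\},\qquad \underline{\ell}=\lfloor \log_2(r/3)\rfloor .$$ Then, with probability at least $1-2e^{-r}$, for all $f\in\mathcal F$ simultaneously, $$\mathbb E_n f(X)-4e\sqrt{\frac{r+k}{n}}\,\|f\|_{\psi_{2,r+k}}-4e\sqrt{\frac{2r+1}{n}}\,\|f-A[f]\|_{\psi_{2,2r+1}}\le C\,\frac{\gamma^\flat(\mathcal A;\underline{\ell})}{\sqrt n}.$$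
   Context: $X$ is a random variable with values in a space $\mathcal X$, $X_1,\dots,X_n$ are i.i.d. copies of $X$, and $\mathbb E_n f(X)=\frac1n\sum_{i=1}^n f(X_i)$ is the empirical average. $\mathbb V$ is a vector space of (measurable) functions $g:\mathcal X\to\mathbb R$ with $\mathbb E g(X)=0$ and finite moments $\mathbb E|g(X)|^q<\infty$ of every order $q\ge1$. $\mathcal F\subset\mathbb V$ is a finite set containing the zero function. For $g\in\mathbb V$ and $q\ge 1$ let $\|g\|_{L_q}=(\mathbb E|g(X)|^q)^{1/q}$, and for $p\ge1$ $$\|g\|_{\psi_{2,p}}=\sup_{q\in[1,p]}\frac{\|g\|_{L_q}}{\sqrt q}.$$ For $a\in\mathbb V$ and a set $\mathcal H\subseteq\mathbb V$, $\|a-\mathcal H\|_{\psi_{2,p}}=\inf_{h\in\mathcal H}\|a-h\|_{\psi_{2,p}}$. For an integer $\underline{\ell}$, $$\gamma^\flat(\mathcal A;\underline{\ell})=\inf_{(\mathcal A_i)_{i\ge0}}\ \sup_{a\in\mathcal A}\ \sum_{\ell\ge\underline{\ell}}2^{\ell/2}\,\|a-\mathcal A_\ell\|_{\psi_{2,2^{\ell+4}}},$$ where the infimum is over increasing (with respect to inclusion) sequences $(\mathcal A_i)_{i\ge0}$ of subsets of $\mathcal A$ with $\mathcal A_0=\{0\}$ and $|\mathcal A_i|\le 2^{2^i}$ for $i\ge1$. If $\underline{\ell}<0$, set $\mathcal A_\ell=\{0\}$ for $\ell<0$. *)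

(* Defs.v *)
From HB Require Import structures.
From mathcomp Require Import all_boot all_order all_algebra finmap.
From mathcomp Require Import all_classical all_reals all_analysis.

Set Implicit Arguments.
Unset Strict Implicit.
Unset Printing Implicit Defensive.

Import Order.TTheory GRing.Theory Num.Theory.
Import numFieldNormedType.Exports.

Local Open Scope classical_set_scope.
Local Open Scope ring_scope.
Local Open Scope ereal_scope.

Section definitions.
Context {R : realType} {d d' : measure_display}.
Context {Omega : measurableType d} {T : measurableType d'}.
Variable P : probability Omega R.

Definition mutually_independent (I : finType) (Xs : I -> {RV P >-> T}) : Prop :=
  forall (J : {set I}) (B : I -> set T), (forall i, measurable (B i)) ->
    P (\bigcap_(i in [set` J]) (Xs i @^-1` B i)) =
    \prod_(i in J) P (Xs i @^-1` B i).

Definition iid_copies (X : {RV P >-> T}) (n : nat) (Xs : 'I_n -> {RV P >-> T})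
    : Prop :=
  mutually_independent Xs /\
  forall (i : 'I_n) (B : set T), measurable B ->
    distribution P (Xs i) B = distribution P X B.

Variable X : {RV P >-> T}.

(* Moments of order 1 are finite, so the centering condition concerns the
   integral of an integrable function.
   Functions are not identified up to almost sure equality. *)
Definition centered_moment_space (V : set (T -> R)) : Prop :=
  [/\ V 0%R,
      forall g h, V g -> V h -> V (g + h)%R,
      forall (c : R) g, V g -> V (c *: g)%R &
      forall g, V g ->
        [/\ measurable_fun setT g,
            forall q : R, (1 <= q)%R ->
              'E_P[(fun w => `|g (X w)| `^ q)%R] < +oo &
            'E_P[(fun w => g (X w))] = 0]].

Definition psi2_norm (p : R) (g : T -> R) : \bar R :=
  ereal_sup [set 'N[P]_(q%:E)[EFin \o (g \o X)] * ((Num.sqrt q)^-1)%:E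
            | q in `[1%R, p]].

Definition psi2_dist (p : R) (a : T -> R) (H : set (T -> R)) : \bar R :=
  ereal_inf [set psi2_norm p (a - h)%R | h in H].

Definition admissible (A : set (T -> R)) (As : nat -> set (T -> R)) : Prop :=
  [/\ forall i, As i `<=` A,
      forall i, As i `<=` As i.+1,
      As 0%N = [set 0%R] &
      forall i, (1 <= i)%N -> (As i #<= `I_(2 ^ (2 ^ i))%N)%card].

Definition extend_seq (As : nat -> set (T -> R)) (l : int) : set (T -> R) :=
  match l with Posz i => As i | Negz _ => [set 0%R] end.

(* With values in \bar R; in particular the infimum over an empty class of
   admissible sequences, which occurs when 0 is not in A, is +oo. *)
Definition gamma_flat (A : set (T -> R)) (l0 : int) : \bar R :=
  ereal_inf
    [set ereal_sup
       [set \esum_(l in [set l : int | (l0 <= l)%R])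
              (2 `^ (l%:~R / 2))%R%:E *
              psi2_dist (2 ^ (l + 4))%R a (extend_seq As l)
       | a in A]
    | As in admissible A].

End definitions.

Definition empirical_mean {R : realType} {Omega T : Type} (n : nat)
    (Xs : 'I_n -> Omega -> T) (f : T -> R) (w : Omega) : R :=
  (n%:R^-1 * \sum_(i < n) f (Xs i w))%R.

(* Main.v *)
Require Import Defs.
From HB Require Import structures.
From mathcomp Require Import all_boot all_order all_algebra finmap.
From mathcomp Require Import all_classical all_reals all_analysis.
From mathcomp Require Import measurable_realfun.
From mathcomp Require Import ring lra zify.

Set Implicit Arguments.
Unset Strict Implicit.
Unset Printing Implicit Defensive.

Import Order.TTheory GRing.Theory Num.Theory.
Import numFieldNormedType.Exports.

Local Open Scope classical_set_scope.
Local Open Scope ring_scope.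
Local Open Scope ereal_scope.

(** Split f = A f + (f - A f). The functions A f are at most e^k in number, and
    a single centred g satisfies
      P(E_n g > 4 e sqrt(p/n) |g|_{psi_2,p}) <= e^{-p}  for real p >= 2,
    so a union bound with p = r + k handles them. The functions f - A f are
    chained, with moment order 2^{l+4} on the links of level l and order 2r+1
    for the starting points; 2^l0 lies in [r/6, r/3], so the numbers of links
    are compensated by the tails and all failure probabilities add up to at
    most e^{-r}.

    The tail bound is Markov's inequality for S^{2m}, S = sum_i g(X_i) and
    2m <= p < 2m+2. Its moments are controlled without symmetrization: with
    F = sum_{c <= 2m} lam^c |E g^c| / c!, independence gives
      |E S^a| <= a! lam^{-a} F^n  for a <= 2m,
    a coefficientwise comparison of exponential generating functions. As
    E g = 0, odd moments are averaged between the two neighbouring even ones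
    and F <= exp(3 lam^2 |g|_{psi_2,p}^2); then optimize lam. *)

(** * Numerical estimates *)

Section numerics.
Variable R : realType.
Local Open Scope ring_scope.

(** Tenth power of [9/10 <= expR (- (1/10))], then inversion. The bound 3 would be too coarse for
    the proofs of [tail_const_le] and [tail_ratio_le2]. *)
Lemma expR1_le : expR 1 <= 23 / 8 :> R.
Proof.
have h : 9 / 10 <= expR (- (1 / 10)) :> R.
  by apply: le_trans (expR_ge1Dx _); lra.
have : (9 / 10) ^+ 10 <= expR (- (1 / 10)) ^+ 10 :> R.
  by rewrite lerXn2r// nnegrE ?expR_ge0//; lra.
rewrite -expRM_natr (_ : - (1 / 10) * 10%:R = - 1 :> R); last by field.
rewrite expRN => k.
have e0 : 0 < expR 1 :> R by exact: expR_gt0.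
rewrite -(invrK (23 / 8)) -[expR 1]invrK lef_pV2 ?posrE ?invr_gt0//.
by apply: le_trans k; lra.
Qed.

Lemma expR1_ge2 : 2 <= expR 1 :> R.
Proof. by apply: le_trans (expR_ge1Dx _); lra. Qed.

Lemma exp_sum_le_expR (x : R) n : 0 <= x ->
  \sum_(j < n) x ^+ j / j`!%:R <= expR x.
Proof.
move=> x0; rewrite -(big_mkord xpredT (fun j => x ^+ j / j`!%:R)).
apply: (nondecreasing_cvgn_le (u_ := series (exp_coeff x)) _ _ n).
  apply/nondecreasing_seqP => k; rewrite /series/= big_nat_recr//= lerDl.
  exact: exp_coeff_ge0.
exact: is_cvg_series_exp_coeff.
Qed.

(** Against the factors [j + 1, ..., 2 * j - 1] of the factorial each [2 * j] loses at most 2, and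
    against the last factor [2 * j] it loses nothing; hence the exponent [j.-1]. *)
Lemma double_expn_fact_le j : (0 < j)%N ->
  ((2 * j) ^ j * j`! <= 2 ^ j.-1 * (2 * j)`!)%N.
Proof.
case: j => // j _; set k := j.+1.
have H i : ((2 * k) ^ i * k`! <= 2 ^ i * (k + i)`!)%N.
  elim: i => [|i IH]; first by rewrite addn0.
  rewrite !expnS addnS factS -mulnA.
  have : (2 * k <= 2 * (k + i).+1)%N by lia.
  move=> /leq_mul/(_ IH) /leq_trans; apply.
  by apply/eq_leq; ring.
have := H j; rewrite (_ : k + j = (2 * k).-1)%N; last by rewrite /k; lia.
have -> : ((2 * k)`! = 2 * k * (2 * k).-1`!)%N by rewrite -[in LHS](@prednK (2*k)).
rewrite [((2 * k) ^ k)%N]expnS => h.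
by rewrite -mulnA [leqRHS]mulnCA leq_mul2l h orbT.
Qed.

Lemma expn2_linear_le j : (0 < j)%N -> (2 ^ j.-1 * (6 * j + 7) <= 6 * 3 ^ j)%N.
Proof.
case: j => // j _; elim: j => // j IH.
move: IH; rewrite /= (expnS 2 j) (expnS 3 j.+1).
set a := (2 ^ j)%N; set b := (3 ^ _)%N => IH.
have : (0 <= a * j)%N by [].
by move: IH; rewrite !mulnDr !mulnS; lia.
Qed.

(** Induction from the equality case [m = 2]: one step multiplies the factorial by at most
    [4 * (m + 1)^2] and the power by at least as much, since Bernoulli's inequality gives
    [(1 + 1/m)^(2m) >= 4]. *)
Lemma fact_double_le m : (1 < m)%N -> (2 * (2 * m)`! <= 3 * m ^ (2 * m))%N.
Proof.
have bern a k : (0 < a)%N -> (a ^ k * (a + k) <= a.+1 ^ k * a)%N.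
  move=> a0; elim: k => [|k IH]; first by rewrite addn0.
  rewrite !expnS -!mulnA.
  have : (a.+1 * (a ^ k * (a + k)) <= a.+1 * (a.+1 ^ k * a))%N.
    by rewrite leq_mul2l IH orbT.
  by apply: leq_trans; nia.
case: m => [|[|m]]// _; elim: m => // m.
set k := m.+2 => IH.
have k2 : (k ^ k * 2 <= k.+1 ^ k)%N.
  have := bern k k isT; rewrite addnn -mul2n mulnA leq_pmul2r//.
have k4 : (4 * k ^ (2 * k) <= k.+1 ^ (2 * k))%N.
  rewrite mul2n -addnn !expnD; apply: leq_trans (leq_mul k2 k2).
  by rewrite mulnACA mulnC.
rewrite (_ : 2 * k.+1 = (2 * k).+2)%N; last by lia.
rewrite 2!factS 2!(expnS k.+1).
move: IH k4; set f := (2 * k)`!; set u := (k ^ _)%N; set v := (k.+1 ^ _)%N => IH k4.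
have : (2 * ((2 * k).+2 * ((2 * k).+1 * f)) <= (2 * k).+2 * (2 * k).+2 * (3 * u))%N.
  have := leq_mul (leqnSn (2 * k).+1) IH; nia.
move=> /leq_trans; apply.
by have := leq_mul (leqnn (3 * (k.+1 * k.+1))) k4; lia.
Qed.

(** The bracket is what gets charged to order [2 * j] in [moment_series_le]: 1 for the term itself,
    [j] for half of the term of order [2 * j - 1], whose factorial is smaller by [2 * j], and the
    rest for half of the term of order [2 * j + 1]. *)
Lemma even_moment_coef_le (j : nat) : (0 < j)%N ->
  (2 * j)%:R ^+ j / (2 * j)`!%:R * (1 + j%:R + 2^-1 / (2 * j).+1%:R)
  <= 3 ^+ j / j`!%:R :> R.
Proof.
move=> j0.
have f0 k : 0 < k`!%:R :> R by rewrite ltr0n fact_gt0.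
have a1 : (2 * j)%:R ^+ j / (2 * j)`!%:R <= 2 ^+ j.-1 / j`!%:R :> R.
  rewrite ler_pdivrMr// mulrAC ler_pdivlMr// -!natrX -!natrM ler_nat.
  exact: double_expn_fact_le.
have a2 : 1 + j%:R + 2^-1 / (2 * j).+1%:R <= (6 * j + 7)%:R / 6 :> R.
  have : 2^-1 / (2 * j).+1%:R <= 2^-1 / 3 :> R.
    rewrite ler_wpM2l ?invr_ge0// lef_pV2 ?posrE// ler_nat; lia.
  rewrite natrD natrM; move: (_ / (2 * j).+1%:R) => y; lra.
apply: (le_trans (ler_pM _ _ a1 a2)).
- by rewrite mulr_ge0 ?exprn_ge0// invr_ge0.
- by rewrite !addr_ge0// mulr_ge0// invr_ge0.
rewrite mulrAC ler_wpM2r ?invr_ge0// mulrA ler_pdivrMr// mulrC [leRHS]mulrC.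
by rewrite -!natrX -!natrM ler_nat mulnC expn2_linear_le.
Qed.

(* The series is compared with that of [expR (3 * x)], [x = lam^2 K^2], level by
   level: half of each odd term is charged to the even term before it and half
   to the one after, and the term [e k * ...] added in the induction reserves
   room for the charge coming from order [2k+1]. *)
Lemma moment_series_le (mu : nat -> R) (lam K : R) (m : nat) :
  0 <= lam -> mu 0%N = 1 -> mu 1%N = 0 -> (0 < m)%N ->
  (forall j, (0 < j <= m)%N -> 0 <= mu (2 * j)%N <= (K ^+ 2 * (2 * j)%:R) ^+ j) ->
  (forall j, (0 < j < m)%N -> lam ^+ (2 * j).+1 * `|mu (2 * j).+1| <=
     (lam ^+ (2 * j) * mu (2 * j)%N + lam ^+ (2 * j.+1) * mu (2 * j.+1)%N) / 2) ->
  \sum_(c < (2 * m).+1) lam ^+ c * `|mu c| / c`!%:R <=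
    expR (3 * (lam ^+ 2 * K ^+ 2)).
Proof.
move=> lam0 mu0 mu1 m0 hev hodd; set x := lam ^+ 2 * K ^+ 2.
have x0 : 0 <= x by rewrite mulr_ge0// ?sqr_ge0// exprn_ge0.
have f0 k : 0 < k`!%:R :> R by rewrite ltr0n fact_gt0.
pose e j := x ^+ j * (2 * j)%:R ^+ j.
have e0 j : 0 <= e j by rewrite mulr_ge0 ?exprn_ge0.
have He j : (0 < j <= m)%N -> lam ^+ (2 * j) * mu (2 * j)%N <= e j.
  move=> jm; have /andP[_ h] := hev j jm.
  rewrite /e /x exprMn -mulrA -exprMn exprM ler_wpM2l// ?exprn_ge0//.
apply: (@le_trans _ _ (\sum_(j < m.+1) (3 * x) ^+ j / j`!%:R)); last first.
  by apply: exp_sum_le_expR; rewrite mulr_ge0.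
suff H k : (0 < k <= m)%N ->
  \sum_(c < (2 * k).+1) lam ^+ c * `|mu c| / c`!%:R
    + e k * (2^-1 / (2 * k).+1`!%:R) <= \sum_(j < k.+1) (3 * x) ^+ j / j`!%:R.
  apply: le_trans (H m _); last by rewrite m0 leqnn.
  by rewrite lerDl mulr_ge0// mulr_ge0// invr_ge0 ltW.
have coefk j : (0 < j)%N -> e j * ((2 * j)`!%:R^-1 * (1 + j%:R + 2^-1 / (2 * j).+1%:R))
     <= (3 * x) ^+ j / j`!%:R.
  move=> j0; rewrite /e [in leRHS]exprMn [3 ^+ j * _]mulrC -!mulrA ler_wpM2l ?exprn_ge0//.
  by rewrite mulrA even_moment_coef_le.
elim: k => // k IH /andP[_ km].
(* Order 1 contributes nothing because [mu 1 = 0]; the budget of order 0 is used up by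
   [mu 0 = 1]. *)
have [->|k0] := eqVneq k 0%N.
  rewrite !big_ord_recr !big_ord0/= mu0 mu1 normr1 normr0 !expr0 !mulr0 mul0r.
  have := He 1%N; rewrite m0 => /(_ isT) h1.
  have := coefk 1%N isT.
  have /andP[h2 _] := hev 1%N m0.
  rewrite ger0_norm// !muln1.
  have -> : 3`!%:R = 6 :> R by [].
  have -> : 2`!%:R = 2 :> R by [].
  have -> : 1`!%:R = 1 :> R by [].
  move: h1 (e0 1%N); rewrite !muln1 !expr1.
  by set y := lam ^+ 2 * mu 2%N; move: (e 1%N) => z; lra.
have /IH {}IH : (0 < k <= m)%N by rewrite lt0n k0 ltnW.
rewrite (_ : 2 * k.+1 = (2 * k).+2)%N; last by lia.
rewrite 2!big_ord_recr [leRHS]big_ord_recr/=.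
move: IH; set S := \sum_(c < _) _; set Q := \sum_(j < _) _ => IH.
have := coefk k.+1 isT; rewrite (_ : 2 * k.+1 = (2 * k).+2)%N; last by lia.
have hO : lam ^+ (2 * k).+1 * `|mu (2 * k).+1| <= (e k + e k.+1) / 2.
  apply: le_trans (hodd k _) _; first by rewrite lt0n k0.
  by rewrite ler_wpM2r ?invr_ge0// lerD ?He// lt0n k0 ltnW.
have hE : lam ^+ (2 * k).+2 * `|mu (2 * k).+2| <= e k.+1.
  have := hev k.+1 km; have := He k.+1 km.
  by rewrite (_ : 2 * k.+1 = (2 * k).+2)%N; [move=> h /andP[/ger0_norm ->]|lia].
have F2 : ((2 * k).+2)`!%:R^-1 = (2 * k).+2%:R^-1 / ((2 * k).+1)`!%:R :> R.
  by rewrite factS natrM invfM.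
have F3 : ((2 * k).+3)`!%:R^-1 =
    (2 * k).+3%:R^-1 * ((2 * k).+2%:R^-1 / ((2 * k).+1)`!%:R) :> R.
  by rewrite -F2 factS natrM invfM.
move: hO hE (e0 k.+1) IH; rewrite F3 F2.
have : 0 <= ((2 * k).+1)`!%:R^-1 :> R by rewrite invr_ge0.
have : 0 < (2 * k).+2%:R^-1 :> R by rewrite invr_gt0.
have : 1 + k.+1%:R = (2 * k).+2%:R / 2 + 1 :> R.
  by rewrite (_ : (2 * k).+2 = 2 * k.+1)%N ?natrM; [field|lia].
move: (lam ^+ (2 * k).+1 * _) (lam ^+ (2 * k).+2 * _) (e k) (e k.+1) => E O ek ek1.
have : (2 * k).+2%:R != 0 :> R by rewrite pnatr_eq0.
move: ((2 * k).+3%:R^-1) ((2 * k).+2%:R) (((2 * k).+1)`!%:R^-1) => t c v cN0.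
move: ((3 * x) ^+ k.+1 / _) (1 + k.+1%:R) => z _ -> c0 v0 hE hO ek0 IH h.
have h1 : E * v <= (ek + ek1) / 2 * v by rewrite ler_wpM2r.
have h2 : O * (c^-1 * v) <= ek1 * (c^-1 * v) by rewrite ler_wpM2r// mulr_ge0// ltW.
have h3 : ek1 * (c^-1 * v * (c / 2 + 1 + 2^-1 * t)) =
  ek1 * v / 2 + ek1 * (c^-1 * v) + ek1 * (2^-1 * (t * (c^-1 * v))) by field.
move: h1 h2 h; rewrite h3.
move: (O * _) (E * _) (ek1 * (2^-1 * _)) (ek1 * (c^-1 * v)) => E1 O1 a1 a2.
rewrite mulrA in IH; lra.
Qed.

(** [fact_double_le] bounds the first quotient by [3/2]; as [3/32 * e < 1], the worst case is
    [m = 2], where [3/2 * (3/32 * e)^2 * e^2 <= 1]. *)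
Lemma tail_const_le (m : nat) : (1 < m)%N ->
  (2 * m)`!%:R / m%:R ^+ (2 * m) * (3 / 32) ^+ m <= expR (- (m + 2)%:R) :> R.
Proof.
move=> m1; have [e2 e3] := (expR1_ge2, expR1_le).
have m0 : 0 < m%:R :> R by rewrite ltr0n ltnW.
apply: (@le_trans _ _ (3 / 2 * (3 / 32) ^+ m)).
  rewrite ler_wpM2r ?exprn_ge0// ler_pdivrMr ?exprn_gt0//.
  have := fact_double_le m1; rewrite -(ler_nat R) !natrM natrX; lra.
rewrite -[X in expR (- X)]mulr1 -mulrN expRM_natl expRN exprVn.
rewrite -[leRHS]mul1r ler_pdivlMr ?exprn_gt0 ?expR_gt0//.
have -> : 3 / 2 * (3 / 32) ^+ m * expR 1 ^+ (m + 2) =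
    3 / 2 * (3 / 32 * expR 1) ^+ m * expR 1 ^+ 2 :> R.
  by rewrite (exprMn _ _ (expR 1)) exprD !mulrA.
have b1 : 3 / 32 * expR 1 <= 3 / 32 * (23 / 8) :> R by rewrite ler_wpM2l.
have b0 : 0 <= 3 / 32 * expR 1 :> R by rewrite mulr_ge0// expR_ge0.
have b2 : (3 / 32 * expR 1) ^+ m <= (3 / 32 * (23 / 8)) ^+ 2 :> R.
  apply: (@le_trans _ _ ((3 / 32 * expR 1) ^+ 2)); last first.
    by rewrite lerXn2r// nnegrE//; lra.
  by rewrite ler_wiXn2l//; lra.
have e4 : expR 1 ^+ 2 <= (23 / 8) ^+ 2 :> R by rewrite lerXn2r// nnegrE ?expR_ge0//; lra.
apply: (@le_trans _ _ (3 / 2 * (3 / 32 * (23 / 8)) ^+ 2 * (23 / 8) ^+ 2)); last by lra.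
by rewrite ler_pM// ?mulr_ge0 ?exprn_ge0 ?expR_ge0// ler_wpM2l.
Qed.

(** This [lam] minimizes the left-hand side and turns its exponential factor into [expR m]. The
    bound [p <= 2m + 2] serves to reach [expR (- p)], and [2m <= p] to put [p] under the square
    root. *)
Lemma tail_ratio_le (m n : nat) (p K lam : R) : (1 < m)%N -> (0 < n)%N -> 0 < K ->
  (2 * m)%:R <= p <= (2 * m).+2%:R ->
  lam ^+ 2 = m%:R / (3 * n%:R * K ^+ 2) ->
  (2 * m)`!%:R * lam ^- (2 * m) * expR (3 * (lam ^+ 2 * K ^+ 2)) ^+ n <=
  expR (- p) * (4 * expR 1 * Num.sqrt (p * n%:R) * K) ^+ (2 * m).
Proof.
move=> m1 n0 K0 /andP[mp pm] lam2.
have m0 : 0 < m%:R :> R by rewrite ltr0n ltnW.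
have n0R : 0 < n%:R :> R by rewrite ltr0n.
have e0 : 0 < expR 1 :> R by exact: expR_gt0.
have p0 : 0 <= p by apply: le_trans mp.
rewrite exprM lam2.
have -> : 3 * (m%:R / (3 * n%:R * K ^+ 2) * K ^+ 2) = m%:R / n%:R.
  by field; rewrite !gt_eqF.
rewrite -expRM_natr divfK ?gt_eqF//.
(* [expR 1 ^+ 2 * B] is the square of the threshold with [2m] in place of [p]; the factor [(3/32)^m]
   is left over from [lam] and goes to [tail_const_le]. *)
pose B := 32 * m%:R * n%:R * K ^+ 2.
have B0 : 0 < B by rewrite /B !mulr_gt0// exprn_gt0.
have -> : (m%:R / (3 * n%:R * K ^+ 2)) ^- m = (3 / 32) ^+ m / m%:R ^+ (2 * m) * B ^+ m.
  rewrite -exprVn exprM -exprVn -!exprMn; congr (_ ^+ _); rewrite /B.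
  by field; rewrite !gt_eqF.
have Em (k : nat) : expR k%:R = expR 1 ^+ k :> R by rewrite -expRM_natl mulr1.
apply: (@le_trans _ _ (expR (- (m + 2)%:R) * B ^+ m * expR m%:R)).
  rewrite ler_wpM2r ?expR_ge0// mulrA ler_wpM2r ?(exprn_ge0 _ (ltW B0))//.
  by rewrite [_ ^+ m / _]mulrC mulrA; exact: tail_const_le.
apply: (@le_trans _ _ (expR (- p) * (expR 1 ^+ 2 * B) ^+ m)).
  have -> : (expR 1 ^+ 2 * B) ^+ m = expR (2 * m)%:R * B ^+ m.
    by rewrite (exprMn _ _ B) -exprM Em.
  rewrite mulrAC mulrA -!expRD.
  rewrite ler_wpM2r ?(exprn_ge0 _ (ltW B0))// ler_expR.
  move: pm; rewrite -(addn2 (2 * m)) !natrD.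
  by lra.
rewrite ler_wpM2l ?expR_ge0// exprM lerXn2r//.
- by rewrite nnegrE mulr_ge0 ?exprn_ge0 ?(ltW e0) ?(ltW B0).
- by rewrite nnegrE sqr_ge0.
rewrite !exprMn sqr_sqrtr; last by rewrite mulr_ge0// ltW.
rewrite /B; set E := expR 1 ^+ 2.
rewrite [leLHS](_ : _ = (16 * n%:R * K ^+ 2 * E) * (2 * m)%:R); last first.
  by rewrite natrM; ring.
rewrite [leRHS](_ : _ = (16 * n%:R * K ^+ 2 * E) * p); last by ring.
by rewrite ler_wpM2l// !mulr_ge0 ?exprn_ge0 ?ltW.
Qed.

(** The case [m = 1], out of reach of [tail_const_le]. Only the orders 0 and 2 of the series
    survive, so the exponent carries no factor 3, the optimal [lam] changes, and the claim reduces
    to [expR p <= 8 * e * p] on [[2, 4]]. *)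
Lemma tail_ratio_le2 (n : nat) (p K lam : R) : (0 < n)%N -> 0 < K ->
  2 <= p <= 4 ->
  lam ^+ 2 = (n%:R * K ^+ 2)^-1 ->
  2 * lam ^- 2 * expR (lam ^+ 2 * K ^+ 2) ^+ n <=
  expR (- p) * (4 * expR 1 * Num.sqrt (p * n%:R) * K) ^+ 2.
Proof.
move=> n0 K0 /andP[p2 p4] lam2.
have n0R : 0 < n%:R :> R by rewrite ltr0n.
have e0 : 0 < expR 1 :> R by exact: expR_gt0.
have p0 : 0 <= p by apply: le_trans p2.
rewrite lam2.
have -> : (n%:R * K ^+ 2)^-1 * K ^+ 2 = n%:R^-1 by field; rewrite !gt_eqF.
rewrite -expRM_natr mulVf ?gt_eqF// invrK.
rewrite !exprMn sqr_sqrtr; last by rewrite mulr_ge0// ltW.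
have e1 : expR 1 <= 23 / 8 :> R by exact: expR1_le.
have key : 1 <= expR (- p) * (8 * expR 1 * p).
  have e0p : 0 < expR p by exact: expR_gt0.
  rewrite expRN -ler_pdivrMl ?invr_gt0// invrK mulr1.
  (* On [[2, 3]] and on [[3, 4]] it is enough to replace [expR p] by its value at the right end. *)
  have [p3|p3] := leP p 3.
    apply: (@le_trans _ _ (expR 1 ^+ 3)).
      by rewrite -expRM_natl mulr1 ler_expR.
    by rewrite exprS mulrC; nra.
  apply: (@le_trans _ _ (expR 1 ^+ 4)).
    by rewrite -expRM_natl mulr1 ler_expR.
  have h3 : expR 1 ^+ 3 <= (23 / 8) ^+ 3 :> R by rewrite lerXn2r// nnegrE ?ltW//; lra.
  rewrite exprS (mulrC 8) -mulrA ler_wpM2l ?(ltW e0)//.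
  by apply: (le_trans h3); lra.
have q0 : 0 <= 2 * (n%:R * K ^+ 2) * expR 1 by rewrite !mulr_ge0 ?exprn_ge0 ?ltW.
apply: (le_trans (ler_peMr q0 key)).
by rewrite le_eqVlt; apply/orP; left; apply/eqP; ring.
Qed.
End numerics.
(** * Products of independent variables *)

Section independence.
Context {R : realType} {d d' : measure_display}.
Context {Omega : measurableType d} {T : measurableType d'}.
Variable P : probability Omega R.

Import HBNNSimple.

(** Extension from indicators to simple functions by linearity, then to [h] by monotone convergence.
    [W] will be the product of the factors other than the one that depends on [Y]. *)
Lemma ge0_integral_indep_factor (W : Omega -> R) (Y : {mfun Omega >-> T})
    (c : R) (h : T -> R) :
  measurable_fun setT W -> (forall w, 0 <= W w)%R -> (0 <= c)%R ->
  (forall B, measurable B ->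
     \int[P]_w (W w * \1_B (Y w))%:E = c%:E * P (Y @^-1` B)) ->
  measurable_fun setT h -> (forall x, 0 <= h x)%R ->
  \int[P]_w (W w * h (Y w))%:E = c%:E * \int[P]_w (h (Y w))%:E.
Proof.
move=> mW W0 c0 HB mh h0.
have /measurable_EFinP meh := mh.
pose g := nnsfun_approx measurableT meh.
have gh x : (g n x)%:E @[n --> \oo] --> (h x)%:E.
  by apply: (@cvg_nnsfun_approx _ _ _ _ _ _ meh) => // y _; rewrite lee_fin.
have mg n : measurable_fun setT (fun w => g n (Y w)).
  exact: measurableT_comp.
have ndg x : {homo (fun n => g n x) : a b / (a <= b)%N >-> (a <= b)%R}.
  by move=> a b ab; exact/lefP/nd_nnsfun_approx.
(* The weight is arbitrary since the limit is taken on both sides: with [V = W] on the left and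
   [V = 1] on the right. *)
have LW (V : Omega -> R) : measurable_fun setT V -> (forall w, 0 <= V w)%R ->
    \int[P]_w (V w * g n (Y w))%:E @[n --> \oo] -->
    \int[P]_w (V w * h (Y w))%:E.
  move=> mV V0.
  rewrite (eq_integral (fun w => limn (fun n => (V w * g n (Y w))%:E))).
    apply: cvg_monotone_convergence => //.
    - by move=> n; apply/measurable_EFinP/measurable_funM.
    - by move=> n w _; rewrite lee_fin mulr_ge0.
    - by move=> w _ a b ab; rewrite lee_fin ler_wpM2l// ndg.
  move=> w _; apply/esym/cvg_lim => //.
  rewrite [X in X @ _ --> _](_ : _ = fun n => (V w)%:E * (g n (Y w))%:E).
    by rewrite EFinM; apply: cvgeZl.
  by apply/funext => n; rewrite EFinM.
suff key n : \int[P]_w (W w * g n (Y w))%:E = c%:E * \int[P]_w (g n (Y w))%:E.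
  have := LW _ mW W0; under eq_cvg do rewrite key.
  move=> /cvg_lim <- //; apply/cvg_lim => //; apply: cvgeZl => //.
  have := LW (cst 1%R) (measurable_cst _) (fun=> ler01).
  under eq_cvg do under eq_integral do rewrite mul1r.
  by under eq_integral do rewrite mul1r.
have mI r : measurable (g n @^-1` [set r]) by [].
have gE x : (g n x)%:E =
    \sum_(y \in range (g n)) (y%:E * (\1_(g n @^-1` [set y]) x)%:E).
  by rewrite {1}fimfunE -fsumEFin//.
have mgI r : measurable_fun setT (fun w => \1_(g n @^-1` [set r]) (Y w) : R)%R.
  exact: measurableT_comp.
have g0 r x : 0 <= r%:E * (\1_(g n @^-1` [set r]) x)%:E.
  exact: nnfun_muleindic_ge0.
have r0 r x : range (g n) r -> (0 <= r)%R by move=> [y _ <-].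
under eq_integral do rewrite EFinM gE ge0_mule_fsumr//.
under [in RHS]eq_integral do rewrite gE.
rewrite !ge0_integral_fsum//; last 3 first.
- move=> r; apply: emeasurable_funM; apply/measurable_EFinP => //.
- move=> r; apply: emeasurable_funM; first exact/measurable_EFinP.
  by apply: emeasurable_funM; apply/measurable_EFinP => //.
- by move=> r x _; rewrite mule_ge0// lee_fin.
rewrite ge0_mule_fsumr; last by move=> r; apply: integral_ge0.
apply: eq_fsbigr => r /set_mem rr.
under eq_integral do rewrite muleCA -EFinM.
have mWI : measurable_fun setT
    (fun w => (W w * \1_(g n @^-1` [set r]) (Y w))%:E).
  exact/measurable_EFinP/measurable_funM.
under eq_integral do rewrite EFinM.
have r00 : (0 <= r)%R by exact: r0 rr.
rewrite ge0_integralZl ?lee_fin//; last exact/measurable_EFinP.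
rewrite ge0_integralZl ?lee_fin//; last first.
  by move=> *; rewrite lee_fin mulr_ge0.
rewrite HB//.
rewrite (_ : \int[P]_x (\1_(g n @^-1` [set r]) (Y x))%:E =
             P (Y @^-1` (g n @^-1` [set r]))); first by rewrite muleCA.
have mY : measurable (Y @^-1` (g n @^-1` [set r])).
  by rewrite -[X in measurable X]setTI; apply: measurable_funP.
rewrite -[in RHS](setIT (Y @^-1` _)) -integral_indic//.
Qed.

(* Independence gives the case of indicators; the [h i] are then freed one at a
   time, [s] being the list of the indices already freed. *)
Lemma ge0_integral_prod_indep (I : finType) (Xs : I -> {mfun Omega >-> T})
    (h : I -> T -> R) (m : I -> R) :
  mutually_independent (P := P) Xs ->
  (forall i, measurable_fun setT (h i)) -> (forall i x, 0 <= h i x)%R ->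
  (forall i, \int[P]_w (h i (Xs i w))%:E = (m i)%:E) ->
  \int[P]_w (\prod_i h i (Xs i w))%:E = (\prod_i m i)%:E.
Proof.
move=> indep.
have mX i B : measurable B -> measurable (Xs i @^-1` B).
  by move=> mB; rewrite -[X in measurable X]setTI; exact: measurable_funP.
have indicI i B : measurable B ->
    \int[P]_w (\1_B (Xs i w))%:E = P (Xs i @^-1` B).
  by move=> mB; rewrite -[in RHS](setIT (Xs i @^-1` _)) -integral_indic//; exact: mX.
suff H (s : seq I) (h' : I -> T -> R) (m' : I -> R) : (forall i, i \notin s ->
      exists2 B, measurable B & h' i = \1_B) ->
    (forall i, measurable_fun setT (h' i)) -> (forall i x, 0 <= h' i x)%R ->
    (forall i, \int[P]_w (h' i (Xs i w))%:E = (m' i)%:E) ->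
    \int[P]_w (\prod_i h' i (Xs i w))%:E = (\prod_i m' i)%:E.
  by apply: (H (enum I)) => i; rewrite mem_enum.
elim: s h' m' => [|i s IH] h' m' hs mh h0 hm.
  have /choice[B HB] i : exists B, measurable B /\ h' i = \1_B.
    by have [//|B mB hB] := hs i; exists B.
  have mB i : measurable (B i) by have [] := HB i.
  have hB i : h' i = \1_(B i) by have [] := HB i.
  have mPE i : (m' i)%:E = P (Xs i @^-1` B i) by rewrite -indicI// -hB hm.
  rewrite -prodEFin; under [RHS]eq_bigr do rewrite mPE.
  have := indep [set: I]%SET B mB.
  under [in X in _ = X -> _]eq_bigl do rewrite finset.in_setT.
  move=> <-.
  have mcap : measurable (\bigcap_(i in [set` [set: I]%SET]) (Xs i @^-1` B i)).
    by apply: fin_bigcap_measurable => // i _; exact: mX.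
  rewrite -[in RHS](setIT (bigcap _ _)) -integral_indic//.
  apply: eq_integral => w _; congr EFin.
  have [Bw|/existsNP[i Bi]] := pselect (forall i, B i (Xs i w)).
    rewrite [RHS]indicE mem_set; last by move=> i _; exact: Bw.
    by rewrite big1// => i _; rewrite hB indicE mem_set.
  rewrite [RHS]indicE memNset; last first.
    by move=> /(_ i)/(_ _)/Bi; apply; rewrite /= finset.in_setT.
  by rewrite (bigD1 i)//= hB indicE memNset// mul0r.
pose W w := (\prod_(j | j != i) h' j (Xs j w))%R.
pose c := (\prod_(j | j != i) m' j)%R.
have m0 j : (0 <= m' j)%R by rewrite -lee_fin -hm integral_ge0// => w _; rewrite lee_fin.
have mhX j : measurable_fun setT (fun w => h' j (Xs j w)).
  by apply: measurableT_comp.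
have mW : measurable_fun setT W.
  rewrite /W; under eq_fun do rewrite -big_filter.
  by apply: measurable_prod => j _.
have W0 w : (0 <= W w)%R by apply: prodr_ge0.
have c0 : (0 <= c)%R by apply: prodr_ge0.
transitivity (\int[P]_w (W w * h' i (Xs i w))%:E).
  by apply: eq_integral => w _; rewrite (bigD1 i)//= mulrC.
rewrite (ge0_integral_indep_factor (c := c))//.
  by rewrite hm (bigD1 i)//= mulrC.
move=> B mB.
(* Factor [i] becomes an indicator, so that [s] alone lists the free factors and the induction
   hypothesis applies; this gives the identity on events that [ge0_integral_indep_factor] asks
   for. *)
pose h2 j := if j == i then \1_B else h' j.
pose m2 j := if j == i then fine (P (Xs i @^-1` B)) else m' j.
have E1 w : (W w * \1_B (Xs i w) = \prod_j h2 j (Xs j w))%R.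
  rewrite (bigD1 i)//= /h2 eqxx mulrC; congr (_ * _)%R.
  by apply: eq_bigr => j /negPf ->.
under eq_integral do rewrite E1.
rewrite (IH _ m2).
- rewrite (bigD1 i)//= /m2 eqxx mulrC EFinM fineK ?fin_num_measure//; last exact: mX.
  by congr (_%:E * _); apply: eq_bigr => j /negPf ->.
- move=> j js; rewrite /h2; case: eqVneq => [_|ji]; first by exists B.
  by apply: hs; rewrite inE negb_or ji.
- by move=> j; rewrite /h2; case: eqVneq.
- by move=> j x; rewrite /h2; case: eqVneq.
- move=> j; rewrite /h2 /m2; case: eqVneq => [->|//].
  by rewrite indicI// fineK// fin_num_measure//; exact: mX.
Qed.

Lemma integrable_EFin_sum (J : Type) (s : seq J) (f : J -> Omega -> R) :
  (forall j, P.-integrable setT (EFin \o f j)) ->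
  P.-integrable setT (EFin \o (fun w => \sum_(j <- s) f j w)%R).
Proof.
move=> intf; rewrite (_ : _ \o _ = fun w => \sum_(j <- s) (f j w)%:E).
  by apply: integrable_sum => // j _; exact: intf.
by apply/funext => w /=; rewrite sumEFin.
Qed.

Lemma Rintegral_sum (J : Type) (s : seq J) (f : J -> Omega -> R) :
  (forall j, P.-integrable setT (EFin \o f j)) ->
  (\int[P]_w (\sum_(j <- s) f j w) = \sum_(j <- s) \int[P]_w f j w)%R.
Proof.
move=> intf; elim: s => [|j s IH].
  rewrite big_nil; under eq_Rintegral do rewrite big_nil.
  by rewrite Rintegral_cst// mul0r.
rewrite big_cons -IH; under eq_Rintegral do rewrite big_cons.
by rewrite RintegralD//; exact: integrable_EFin_sum.
Qed.

Lemma integrable_EFinZl (c : R) (f : Omega -> R) :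
  P.-integrable setT (EFin \o f) ->
  P.-integrable setT (EFin \o (fun w => c * f w)%R).
Proof.
move=> intf; rewrite (_ : _ \o _ = fun w => c%:E * (f w)%:E)//.
exact: integrableZl.
Qed.

Lemma integrable_EFinD (f g : Omega -> R) :
  P.-integrable setT (EFin \o f) -> P.-integrable setT (EFin \o g) ->
  P.-integrable setT (EFin \o (fun w => f w + g w)%R).
Proof.
by move=> intf intg; rewrite (_ : _ \o _ = (EFin \o f) \+ (EFin \o g));
  [exact: integrableD|apply/funext => w].
Qed.

Lemma integrable_prod_indep (I : finType) (Xs : I -> {mfun Omega >-> T})
    (h : I -> T -> R) :
  mutually_independent (P := P) Xs ->
  (forall i, measurable_fun setT (h i)) ->
  (forall i, P.-integrable setT (EFin \o (fun w => h i (Xs i w)))) ->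
  P.-integrable setT (EFin \o (fun w => \prod_i h i (Xs i w))%R).
Proof.
move=> indep mh inth; apply/integrableP; split.
  apply/measurable_EFinP; apply: measurable_prod => i _.
  exact: measurableT_comp.
under eq_integral do rewrite /= normr_prod.
rewrite (@ge0_integral_prod_indep _ Xs (fun i x => `|h i x|%R)
  (fun i => \int[P]_w `|h i (Xs i w)|)%R) ?ltry//.
  by move=> i; exact: measurableT_comp.
move=> i; rewrite /Rintegral fineK//.
by have /integrable_norm/integrable_fin_num := inth i; exact.
Qed.

(** Each factor is split into its positive and negative parts, the product is expanded over all sign
    patterns, and the nonnegative case applies to each resulting product. *)
Lemma Rintegral_prod_indep (I : finType) (Xs : I -> {mfun Omega >-> T})
    (h : I -> T -> R) :
  mutually_independent (P := P) Xs ->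
  (forall i, measurable_fun setT (h i)) ->
  (forall i, P.-integrable setT (EFin \o (fun w => h i (Xs i w)))) ->
  (\int[P]_w (\prod_i h i (Xs i w)) = \prod_i \int[P]_w h i (Xs i w))%R.
Proof.
move=> indep mh inth.
pose s (b : bool) : R := if b then 1%R else (-1)%R.
(* Positive part for [b = true], negative part for [b = false]. *)
pose u (b : bool) i x : R := ((`|h i x| + s b * h i x) / 2)%R.
have hE i x : h i x = (\sum_(b : bool) s b * u b i x)%R.
  by rewrite /u /s big_bool/=; lra.
have mu b i : measurable_fun setT (u b i).
  apply: measurable_funM => //; apply: measurable_funD.
    exact: measurableT_comp.
  exact: measurable_funM.
have u0 b i x : (0 <= u b i x)%R.
  by rewrite /u /s; case: b; have := ler_norm (h i x);
     have := ler_norm (- h i x)%R; rewrite normrN; lra.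
have intu b i : P.-integrable setT (EFin \o (fun w => u b i (Xs i w))).
  rewrite (_ : (fun w => _) = fun w => (2^-1 * (`|h i (Xs i w)| + s b * h i (Xs i w)))%R).
    apply: integrable_EFinZl; apply: integrable_EFinD.
      exact: integrable_norm.
    exact: integrable_EFinZl.
  by apply/funext => w; rewrite mulrC.
have uE (f : {ffun I -> bool}) :
    (\int[P]_w \prod_i u (f i) i (Xs i w) =
     \prod_i \int[P]_w u (f i) i (Xs i w))%R.
  rewrite {1}/Rintegral (@ge0_integral_prod_indep _ Xs (fun i => u (f i) i)
    (fun i => \int[P]_w u (f i) i (Xs i w))%R)// => i.
  by rewrite /Rintegral fineK//; apply: integrable_fin_num => //; exact: intu.
have intp (f : {ffun I -> bool}) : P.-integrable setT
    (EFin \o (fun w => \prod_i u (f i) i (Xs i w))%R).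
  by apply: (@integrable_prod_indep _ Xs (fun i => u (f i) i)) => // i;
    exact: intu.
transitivity (\sum_(f : {ffun I -> bool}) (\prod_i s (f i)) *
  \int[P]_w \prod_i u (f i) i (Xs i w))%R.
  under [RHS]eq_bigr do rewrite -RintegralZl//.
  rewrite -Rintegral_sum; last by move=> f; exact: integrable_EFinZl.
  apply: eq_Rintegral => w _.
  under eq_bigr do rewrite hE.
  rewrite bigA_distr_bigA; apply: eq_bigr => f _.
  by rewrite big_split.
transitivity (\sum_(f : {ffun I -> bool})
    \prod_i (s (f i) * \int[P]_w u (f i) i (Xs i w)))%R.
  by apply: eq_bigr => f _; rewrite uE -big_split.
rewrite -(bigA_distr_bigA (fun i b => s b * \int[P]_w u b i (Xs i w))%R).
apply: eq_bigr => i _.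
under eq_bigr do rewrite -RintegralZl//.
rewrite -Rintegral_sum; last by move=> b; exact: integrable_EFinZl.
by apply: eq_Rintegral => w _; rewrite [RHS]hE.
Qed.

End independence.

(** * Moments and tails of sums *)

Section moments.
Context {R : realType} {d : measure_display} {Omega : measurableType d}.
Variable P : probability Omega R.
Variables (I : finType) (Y : I -> Omega -> R) (mu : nat -> R).
(** In this section independence and equality of laws enter only through the factorization of mixed
    moments. *)
Hypothesis intY : forall b : I -> nat,
  P.-integrable setT (EFin \o (fun w => \prod_i Y i w ^+ b i)%R).
Hypothesis EY : forall b : I -> nat,
  (\int[P]_w (\prod_i Y i w ^+ b i) = \prod_i mu (b i))%R.

(** The exponents after the binomial formula has taken [Y k ^+ c] out of the power of the sum. *)
Let bump (b : I -> nat) k c : I -> nat := fun i => (b i + (i == k) * c)%N.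

Let prod_bump b k c w :
  (\prod_i Y i w ^+ bump b k c i = Y k w ^+ c * \prod_i Y i w ^+ b i)%R.
Proof.
under eq_bigr do rewrite exprD.
rewrite big_split/= mulrC (bigD1 k)//= eqxx mul1n big1 ?mulr1// => i /negPf ->.
by rewrite mul0n expr0.
Qed.

Let sum_cons k s a b w :
  ((\sum_(i <- k :: s) Y i w) ^+ a * \prod_i Y i w ^+ b i =
   \sum_(c < a.+1) 'C(a, c)%:R * ((\sum_(i <- s) Y i w) ^+ (a - c) *
     \prod_i Y i w ^+ bump b k c i))%R.
Proof.
rewrite big_cons addrC exprDn mulr_suml; apply: eq_bigr => c _.
by rewrite prod_bump -mulrnAl -mulr_natl !mulrA.
Qed.

Lemma integrable_sum_exp (s : seq I) a b :
  P.-integrable setT (EFin \o (fun w =>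
    (\sum_(i <- s) Y i w) ^+ a * \prod_i Y i w ^+ b i)%R).
Proof.
elim: s a b => [|k s IH] a b.
  by under eq_fun do rewrite big_nil; exact: integrable_EFinZl.
under eq_fun do rewrite sum_cons.
by apply: integrable_EFin_sum => c; apply: integrable_EFinZl; exact: IH.
Qed.

(* The factors [Y i ^+ b i] with [i] outside of [s] are carried along so that
   the induction on [s] can absorb the powers split off by the binomial
   formula. *)
Lemma normr_moment_sum_le (lam : R) (M a : nat) (b : I -> nat) (s : seq I) :
  (0 < lam)%R -> mu 0%N = 1%R -> uniq s ->
  (a <= M)%N -> (forall i, i \in s -> b i = 0%N) ->
  (`|\int[P]_w ((\sum_(i <- s) Y i w) ^+ a * \prod_i Y i w ^+ b i)| <=
   a`!%:R * lam ^- a * (\sum_(c < M.+1) lam ^+ c * `|mu c| / c`!%:R) ^+ size s *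
   \prod_i `|mu (b i)|)%R.
Proof.
move=> lam0 mu0; set F := (\sum_(_ < _) _)%R.
have F0 : (0 <= F)%R.
  by apply: sumr_ge0 => c _; rewrite !mulr_ge0// ?exprn_ge0 ?ltW// invr_ge0.
elim: s a b => [|k s IH] a b.
  move=> _ _ _; under eq_Rintegral do rewrite big_nil.
  rewrite RintegralZl// EY normrM expr0 mulr1 normr_prod ler_wpM2r//.
    by apply: prodr_ge0.
  case: a => [|a]; first by rewrite expr0 fact0 invr1 mulr1 normr1.
  by rewrite expr0n normr0 mulr_ge0// invr_ge0 exprn_ge0// ltW.
rewrite cons_uniq => /andP[ks us] aM bs.
under eq_Rintegral do rewrite sum_cons.
rewrite Rintegral_sum; last first.
  by move=> c; apply: integrable_EFinZl; exact: integrable_sum_exp.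
have bk : b k = 0%N by rewrite bs// mem_head.
(* With ['C(a, c) * (a - c)! = a! / c!] and [lam ^- (a - c) = lam ^- a * lam ^+ c], the index [c]
   contributes exactly the term of order [c] of one more factor [F]. *)
have step (c : 'I_a.+1) :
  (`|\int[P]_w ('C(a, c)%:R * ((\sum_(i <- s) Y i w) ^+ (a - c) *
      \prod_i Y i w ^+ bump b k c i))| <=
   (a`!%:R * lam ^- a * F ^+ size s * \prod_i `|mu (b i)|) *
   (lam ^+ c * `|mu c| / c`!%:R))%R.
  rewrite RintegralZl//; last exact: integrable_sum_exp.
  rewrite normrM normr_nat.
  apply: (le_trans (ler_wpM2l _ (IH (a - c)%N (bump b k c) us _ _))) => //.
  - by rewrite (leq_trans _ aM)// leq_subr.
  - move=> i si; rewrite /bump bs ?inE ?si ?orbT//; case: eqVneq => // ik.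
    by move: ks; rewrite -ik si.
  have -> : (\prod_i `|mu (bump b k c i)| = `|mu c| * \prod_i `|mu (b i)|)%R.
    rewrite (bigD1 k)//= [in RHS](bigD1 k)//= /bump bk eqxx mul1n mu0 normr1 mul1r.
    congr (_ * _)%R; apply: eq_bigr => i /negPf ->.
    by rewrite mul0n addn0.
  have ca : (c <= a)%N by rewrite -ltnS.
  have bf : ('C(a, c)%:R * (a - c)`!%:R = a`!%:R / c`!%:R :> R)%R.
    rewrite -(bin_fact ca) !natrM.
    have : (c`!%:R != 0 :> R)%R by rewrite pnatr_eq0 -lt0n fact_gt0.
    by move=> c0; field.
  have le : (lam ^- (a - c) = lam ^- a * lam ^+ c)%R.
    have ln0 m : (lam ^+ m != 0)%R by rewrite expf_neq0// gt_eqF.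
    have -> : (lam ^+ a = lam ^+ (a - c) * lam ^+ c)%R by rewrite -exprD subnK.
    by field; rewrite !ln0.
  by rewrite le !mulrA bf; rewrite le_eqVlt; apply/orP; left; apply/eqP; ring.
apply: (le_trans (ler_norm_sum _ _ _)).
apply: (le_trans (ler_sum _ (fun c _ => step c))).
rewrite -mulr_sumr [leRHS](_ : _ = (a`!%:R * lam ^- a * F ^+ size s *
  \prod_i `|mu (b i)|) * F)%R; last by rewrite /= exprSr; ring.
apply: ler_wpM2l.
  by rewrite !mulr_ge0 ?prodr_ge0 ?exprn_ge0// invr_ge0 exprn_ge0// ltW.
(* The binomial sum stops at order [a <= M]; the other terms of [F] are nonnegative. *)
rewrite /F -!(big_mkord xpredT (fun c => lam ^+ c * `|mu c| / c`!%:R)%R).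
rewrite [leRHS](big_cat_nat _ (n := a.+1))//= lerDl sumr_ge0// => c _.
by rewrite !mulr_ge0// ?exprn_ge0 ?ltW// invr_ge0.
Qed.

End moments.

(** * Tail bound for the empirical mean of a centred function *)

Section tail.
Context {R : realType} {d d' : measure_display}.
Context {Omega : measurableType d} {T : measurableType d'}.
Variables (P : probability Omega R) (X : {RV P >-> T}).

Lemma eq_distribution_integrable (Z : {RV P >-> T}) (f : T -> R) :
  (forall B, measurable B -> distribution P Z B = distribution P X B) ->
  measurable_fun setT f -> P.-integrable setT (EFin \o (fun w => f (X w))) ->
  P.-integrable setT (EFin \o (fun w => f (Z w))) /\
  (\int[P]_w f (Z w) = \int[P]_w f (X w))%R.
Proof.
move=> ZX mf intf.
have mfZ (Y : {RV P >-> T}) : measurable_fun setT (EFin \o (fun w => f (Y w))).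
  by apply/measurable_EFinP; apply: measurableT_comp.
have mef : measurable_fun setT (EFin \o f) by exact/measurable_EFinP.
have intZ : P.-integrable setT (EFin \o (fun w => f (Z w))).
  apply/integrableP; split => //.
  move/integrableP : intf => [_]; congr (_ < _).
  transitivity (\int[distribution P X]_y `|(f y)%:E|).
    by rewrite ge0_integral_distribution//; exact: measurableT_comp.
  transitivity (\int[distribution P Z]_y `|(f y)%:E|).
    by apply: eq_measure_integral => B mB _; exact/esym/ZX.
  by rewrite ge0_integral_distribution//; exact: measurableT_comp.
split=> //; congr fine.
transitivity (\int[distribution P Z]_y (f y)%:E).
  by rewrite integral_distribution.
transitivity (\int[distribution P X]_y (f y)%:E).
  by apply: eq_measure_integral => B mB _; exact: ZX.
by rewrite integral_distribution.
Qed.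

Variables (n : nat) (Xs : 'I_n -> {RV P >-> T}).
Hypothesis iidX : iid_copies X Xs.
Variable g : T -> R.
Hypothesis mg : measurable_fun setT g.
Hypothesis intg : forall c : nat,
  P.-integrable setT (EFin \o (fun w => g (X w) ^+ c)%R).

Let mu (c : nat) : R := (\int[P]_w (g (X w) ^+ c))%R.
Let S w : R := (\sum_(i < n) g (Xs i w))%R.


Let Ys i w := g (Xs i w).

Let intYs (b : 'I_n -> nat) :
  P.-integrable setT (EFin \o (fun w => \prod_i Ys i w ^+ b i)%R).
Proof.
have [indep ident] := iidX.
apply: (integrable_prod_indep (h := fun i x => g x ^+ b i)%R indep).
  by move=> i; exact: measurable_funX.
by move=> i; have [] := eq_distribution_integrable (ident i)
  (measurable_funX (b i) mg) (intg (b i)).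
Qed.

Let EYs (b : 'I_n -> nat) :
  (\int[P]_w (\prod_i Ys i w ^+ b i) = \prod_i mu (b i))%R.
Proof.
have [indep ident] := iidX.
have H i := eq_distribution_integrable (ident i)
  (measurable_funX (b i) mg) (intg (b i)).
rewrite (Rintegral_prod_indep (h := fun i x => g x ^+ b i)%R indep).
- by apply: eq_bigr => i _; have [] := H i.
- by move=> i; exact: measurable_funX.
- by move=> i; have [] := H i.
Qed.

Let sum_powE a w : (S w ^+ a =
  (\sum_(i <- enum 'I_n) Ys i w) ^+ a * \prod_i Ys i w ^+ 0)%R.
Proof. by rewrite [X in (_ * X)%R]big1 ?mulr1 /S ?big_enum// => i _; rewrite expr0. Qed.

Lemma integrable_sum_pow a : P.-integrable setT (EFin \o (fun w => S w ^+ a)%R).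
Proof.
under eq_fun do rewrite sum_powE.
exact: (integrable_sum_exp intYs _ _ (fun=> 0%N)).
Qed.

Lemma moment_iid_sum_le (lam : R) (a : nat) : (0 < lam)%R ->
  (`|\int[P]_w (S w ^+ a)| <=
   a`!%:R * lam ^- a * (\sum_(c < a.+1) lam ^+ c * `|mu c| / c`!%:R) ^+ n)%R.
Proof.
move=> lam0; under eq_Rintegral do rewrite sum_powE.
have mu0 : mu 0%N = 1%R.
  rewrite /mu; under eq_Rintegral do rewrite expr0.
  by rewrite Rintegral_cst// mul1r; exact: (congr1 fine (probability_setT P)).
have := normr_moment_sum_le intYs EYs (b := fun=> 0%N) lam0 mu0 (enum_uniq 'I_n)
  (leqnn a) (fun _ _ => erefl).
rewrite size_enum_ord; move=> /le_trans; apply.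
by rewrite [X in (_ * X <= _)%R]big1 ?mulr1// => i _; rewrite mu0 normr1.
Qed.

Lemma measurable_iid_sum : measurable_fun setT S.
Proof. by apply: measurable_sum => i; exact: measurableT_comp. Qed.

Lemma markov_even (m : nat) (t : R) : (0 < t)%R ->
  (t ^+ (2 * m))%:E * P [set w | (t < S w)%R] <= (\int[P]_w (S w ^+ (2 * m)))%:E.
Proof.
move=> t0.
have mA : measurable [set w | (t < S w)%R].
  rewrite -[X in measurable X]setTI; have := measurable_iid_sum.
  move=> /(_ measurableT `]t, +oo[%classic (measurable_itv _)).
  congr measurable; congr (_ `&` _).
  by apply/seteqP; split => w /=; rewrite in_itv/= andbT.
have := integrable_sum_pow (2 * m).
move=> intS; rewrite /Rintegral fineK; last exact: integrable_fin_num.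
rewrite -[X in P X]setIT -integral_indic// -ge0_integralZl//; last 2 first.
- exact/measurable_EFinP.
- by rewrite lee_fin exprn_ge0// ltW.
apply: ge0_le_integral => //.
- by move=> w _; rewrite mule_ge0// lee_fin exprn_ge0// ltW.
- by apply: measurable_funeM; exact/measurable_EFinP.
- exact/measurable_EFinP/measurable_funX/measurable_iid_sum.
move=> w _; rewrite -EFinM lee_fin indicE; have [tS|tS] := pselect (t < S w)%R.
  rewrite mem_set// mulr1 lerXn2r// ?nnegrE; exact: ltW (lt_trans _ tS) || exact: ltW.
by rewrite memNset// mulr0 exprM exprn_ge0// sqr_ge0.
Qed.


(** Pointwise, with [z = lam * |g X|], this is [z <= (1 + z^2) / 2] multiplied by [z^(2j)]. *)
Let mu_odd_le (lam : R) j : (0 < j)%N -> (0 < lam)%R ->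
  (lam ^+ (2 * j).+1 * `|mu (2 * j).+1| <=
    (lam ^+ (2 * j) * mu (2 * j) + lam ^+ (2 * j.+1) * mu (2 * j.+1)) / 2)%R.
Proof.
move=> j0 lam0; have lamge0 := ltW lam0.
have mfX c : measurable_fun setT (fun w => g (X w) ^+ c)%R.
  by apply: measurable_funX; exact: measurableT_comp.
rewrite /mu -!RintegralZl// -RintegralD//; last 2 first.
- exact: integrable_EFinZl.
- exact: integrable_EFinZl.
rewrite [leRHS]mulrC -RintegralZl//; last first.
  by apply: integrable_EFinD; exact: integrable_EFinZl.
apply: (@le_trans _ _ (lam ^+ (2 * j).+1 *
    \int[P]_w `|g (X w) ^+ (2 * j).+1|)%R).
  by rewrite ler_wpM2l ?exprn_ge0//; exact: le_normr_Rintegral.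
rewrite -RintegralZl//; last exact: integrable_norm.
apply: le_Rintegral => //.
- by apply: integrable_EFinZl; exact: integrable_norm.
- by apply: integrable_EFinZl; apply: integrable_EFinD; exact: integrable_EFinZl.
move=> w _; rewrite normrX; set y := `|g (X w)|%R.
have gE c : (g (X w) ^+ (2 * c) = y ^+ (2 * c))%R.
  by rewrite !exprM /y real_normK// num_real.
rewrite !gE -!exprMn; set z := (lam * y)%R.
have z0 : (0 <= z ^+ (2 * j))%R by rewrite exprn_ge0// mulr_ge0// normr_ge0.
rewrite (_ : 2 * j.+1 = (2 * j).+2)%N; last by rewrite mulnS.
rewrite !exprS; have := sqr_ge0 (z - 1)%R; rewrite -subr_ge0.
move: (z ^+ (2 * j))%R z0 => u u0; rewrite -subr_ge0 => h.
by have := mulr_ge0 u0 h; lra.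
Qed.

Let mu_even_ge0 j : (0 <= mu (2 * j))%R.
Proof. by apply: Rintegral_ge0 => w _; rewrite exprM exprn_ge0// sqr_ge0. Qed.

Let mu_0 : mu 0%N = 1%R.
Proof.
rewrite /mu; under eq_Rintegral do rewrite expr0.
by rewrite Rintegral_cst// mul1r; exact: (congr1 fine (probability_setT P)).
Qed.

Lemma iid_mean_tail_pos (K p : R) : (0 < n)%N -> (0 < K)%R -> (2 <= p)%R ->
  (\int[P]_w g (X w) = 0)%R ->
  (forall j, (0 < j)%N -> ((2 * j)%:R <= p)%R ->
     (mu (2 * j) <= (K ^+ 2 * (2 * j)%:R) ^+ j)%R) ->
  P [set w | (4 * expR 1 * Num.sqrt (p / n%:R) * K < empirical_mean Xs g w)%R]
    <= (expR (- p))%:E.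
Proof.
move=> n0 K0 p2 centered hev.
have n0R : (0 < n%:R :> R)%R by rewrite ltr0n.
have p0 : (0 < p)%R by lra.
have mu_1 : mu 1%N = 0%R by [].
(* The threshold for the sum [S], which is [n] times the mean: [n * sqrt (p / n) = sqrt (p * n)]. *)
pose t := (4 * expR 1 * Num.sqrt (p * n%:R) * K)%R.
have t0 : (0 < t)%R by rewrite !mulr_gt0 ?expR_gt0// sqrtr_gt0 mulr_gt0.
have tE : t = (4 * expR 1 * Num.sqrt (p / n%:R) * K * n%:R)%R.
  have pE : (p * n%:R = p / n%:R * n%:R ^+ 2)%R by field; rewrite gt_eqF.
  rewrite /t pE sqrtrM ?divr_ge0 ?ltW// sqrtr_sqr ger0_norm ?ltW//.
  by ring.
have -> : [set w | (4 * expR 1 * Num.sqrt (p / n%:R) * K <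
      empirical_mean Xs g w)%R] = [set w | (t < S w)%R].
  apply: eq_set => w; rewrite /empirical_mean [X in (_ < X)%R]mulrC.
  by rewrite ltr_pdivlMr// -tE.
pose m := Num.truncn (p / 2)%R.
have /andP[m1 m2] : (m%:R <= p / 2 < m.+1%:R)%R by apply: truncn_itv; lra.
have mp : ((2 * m)%:R <= p)%R by rewrite natrM; lra.
have pm : (p <= (2 * m).+2%:R)%R.
  rewrite (_ : (2 * m).+2 = 2 * m.+1)%N ?natrM; last by rewrite mulnS.
  lra.
have m0 : (0 < m)%N.
  by rewrite lt0n; apply/eqP => m0; move: m2; rewrite m0; lra.
have tm0 : (0 < t ^+ (2 * m))%R by rewrite exprn_gt0.
suff main : (\int[P]_w (S w ^+ (2 * m)) <= expR (- p) * t ^+ (2 * m))%R.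
  rewrite -(@lee_pmul2l _ (t ^+ (2 * m))%:E)// ?lte_fin//.
  apply: le_trans (markov_even _ t0) _.
  by rewrite -EFinM lee_fin mulrC.
apply: le_trans (ler_norm _) _.
have [m1'|m1'] := leqP m 1.
  have {m1'}mE : m = 1%N by apply/eqP; rewrite eqn_leq m1'.
  pose lam := Num.sqrt ((n%:R * K ^+ 2)^-1)%R.
  have lamE : (lam ^+ 2 = (n%:R * K ^+ 2)^-1)%R.
    by rewrite sqr_sqrtr// invr_ge0 mulr_ge0 ?exprn_ge0 ?ltW.
  have lam0 : (0 < lam)%R by rewrite sqrtr_gt0 invr_gt0 mulr_gt0// exprn_gt0.
  rewrite mE muln1; rewrite mE in pm; have := tail_ratio_le2 (p := p) n0 K0 _ lamE.
  rewrite p2 pm => /(_ isT); apply: le_trans.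
  apply: le_trans (moment_iid_sum_le _ lam0) _.
  rewrite ler_wpM2l//; first by rewrite mulr_ge0// invr_ge0 exprn_ge0// ltW.
  apply: lerXn2r; rewrite ?nnegrE ?expR_ge0//.
    by apply: sumr_ge0 => c _; rewrite !mulr_ge0// ?exprn_ge0 ?ltW// invr_ge0.
  (* The factor 2 in [E g^2 <= 2 * K^2] cancels with [2!], which leaves [1 + lam^2 * K^2]. *)
  rewrite !big_ord_recr big_ord0/= mu_0 mu_1 normr0 normr1 mulr0 mul0r add0r addr0.
  rewrite !expr0 mulr1 fact0 divr1; apply: le_trans (expR_ge1Dx _).
  rewrite lerD2l -mulrA ler_wpM2l ?sqr_ge0//.
  have := hev 1%N isT p2; rewrite expr1.
  rewrite ger0_norm; last exact: (mu_even_ge0 1).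
  by rewrite muln1 ler_pdivrMr.
pose lam := Num.sqrt (m%:R / (3 * n%:R * K ^+ 2))%R.
have lamE : (lam ^+ 2 = m%:R / (3 * n%:R * K ^+ 2))%R.
  by rewrite sqr_sqrtr// divr_ge0// ?mulr_ge0 ?exprn_ge0 ?ltW.
have lam0 : (0 < lam)%R.
  by rewrite sqrtr_gt0 divr_gt0 ?ltr0n// !mulr_gt0// exprn_gt0.
have := tail_ratio_le (p := p) m1' n0 K0 _ lamE; rewrite mp pm => /(_ isT).
apply: le_trans; apply: le_trans (moment_iid_sum_le _ lam0) _.
rewrite ler_wpM2l//; first by rewrite mulr_ge0// invr_ge0 exprn_ge0// ltW.
apply: lerXn2r; rewrite ?nnegrE ?expR_ge0//.
  by apply: sumr_ge0 => c _; rewrite !mulr_ge0// ?exprn_ge0 ?ltW// invr_ge0.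
apply: moment_series_le => //; first exact: ltW.
- move=> j /andP[j0 jm]; rewrite mu_even_ge0 hev//.
  by apply: le_trans mp; rewrite ler_nat leq_mul2l jm orbT.
- by move=> j /andP[j0 jm]; exact: mu_odd_le.
Qed.


Lemma measurable_empirical_gt (c : R) :
  measurable [set w | (c < empirical_mean Xs g w)%R].
Proof.
have mE : measurable_fun setT (empirical_mean Xs g).
  by apply: measurable_funM => //; exact: measurable_iid_sum.
rewrite -[X in measurable X]setTI.
have -> : [set w | (c < empirical_mean Xs g w)%R] =
    empirical_mean Xs g @^-1` `]c, +oo[%classic.
  by apply/seteqP; split => w /=; rewrite in_itv/= andbT.
exact: mE.
Qed.

Lemma iid_mean_tail (K p : R) : (0 < n)%N -> (0 <= K)%R -> (2 <= p)%R ->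
  (\int[P]_w g (X w) = 0)%R ->
  (forall j, (0 < j)%N -> ((2 * j)%:R <= p)%R ->
     (mu (2 * j) <= (K ^+ 2 * (2 * j)%:R) ^+ j)%R) ->
  P [set w | (4 * expR 1 * Num.sqrt (p / n%:R) * K < empirical_mean Xs g w)%R]
    <= (expR (- p))%:E.
Proof.
(* For K = 0, Markov's inequality is void: let positive thresholds decrease to
   0 instead. *)
move=> n0; rewrite le_eqVlt => /predU1P[<-|]; last exact: iid_mean_tail_pos.
move=> p2 centered hev; rewrite mulr0.
set c := (4 * expR 1 * Num.sqrt (p / n%:R))%R.
have c0 : (0 <= c)%R by rewrite !mulr_ge0// expR_ge0.
pose A k := [set w | (c * k.+1%:R^-1 < empirical_mean Xs g w)%R].
have -> : [set w | (0 < empirical_mean Xs g w)%R] = \bigcup_k A k.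
  apply/seteqP; split => [w /= e0|w [k _]]; last first.
    by apply: le_lt_trans; rewrite mulr_ge0// invr_ge0.
  have [k hk] : exists k : nat, (c / empirical_mean Xs g w < k.+1%:R)%R.
    exists (Num.truncn (c / empirical_mean Xs g w)).
    by have /andP[] := truncn_itv (divr_ge0 c0 (ltW e0)).
  exists k => //; rewrite /A/=.
  by rewrite ltr_pdivrMr// mulrC -ltr_pdivrMr// in hk.
have PA k : P (A k) <= (expR (- p))%:E.
  apply: iid_mean_tail_pos => // j j0 jp; apply: le_trans (hev j j0 jp) _.
  by rewrite expr0n/= mul0r expr0n (gtn_eqF j0)/= exprn_ge0// mulr_ge0// sqr_ge0.
have ndA : nondecreasing_seq A.
  move=> k l kl; apply/subsetPset => w; apply: le_lt_trans.
  by rewrite ler_wpM2l// lef_pV2 ?posrE// ler_nat.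
have mA k : measurable (A k) by exact: measurable_empirical_gt.
have := nondecreasing_cvg_mu (mu := P) mA (bigcup_measurable (fun k _ => mA k)) ndA.
move=> /cvg_lim <-//; apply: lime_le; last by apply: nearW => k; exact: PA.
by apply/cvg_ex; eexists; apply: nondecreasing_cvg_mu => //; exact: bigcup_measurable.
Qed.

End tail.

(** * The norms psi_{2,p} *)

Section psi2_norm.
Context {R : realType} {d d' : measure_display}.
Context {Omega : measurableType d} {T : measurableType d'}.
Variables (P : probability Omega R) (X : {RV P >-> T}) (V : set (T -> R)).
Hypothesis cV : centered_moment_space X V.
Local Notation psi := (psi2_norm X).

Lemma centered_sub f g : V f -> V g -> V (f - g)%R.
Proof.
have [_ VD VZ _] := cV => Vf Vg; rewrite -scaleN1r.
by apply: VD => //; exact: VZ.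
Qed.

Lemma centered_measurable g : V g -> measurable_fun setT g.
Proof. by have [_ _ _ H] := cV => /H[]. Qed.

Let mgX g : V g -> measurable_fun setT (g \o X).
Proof. by move=> /centered_measurable mg; exact: measurableT_comp. Qed.

Let int1 : \int[P]_w 1 = 1.
Proof. by rewrite integral_cst// mul1e; exact: probability_setT. Qed.

Lemma psi2_norm_ge0 p g : (1 <= p)%R -> 0 <= psi p g.
Proof.
move=> p1; apply: le_trans (ereal_sup_ubound _); last first.
  by exists 1%R => //=; rewrite in_itv/= lexx.
by rewrite mule_ge0 ?Lnorm_ge0// lee_fin invr_ge0.
Qed.

Lemma psi2_norm_ge q p g : (1 <= q <= p)%R ->
  'N[P]_(q%:E)[EFin \o (g \o X)] * ((Num.sqrt q)^-1)%:E <= psi p g.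
Proof. by move=> qp; apply: ereal_sup_ubound; exists q => //=; rewrite in_itv. Qed.

Lemma psi2_norm_le p g (c : \bar R) :
  (forall q, (1 <= q <= p)%R ->
    'N[P]_(q%:E)[EFin \o (g \o X)] * ((Num.sqrt q)^-1)%:E <= c) -> psi p g <= c.
Proof. by move=> H; apply: ge_ereal_sup => x [q /=]; rewrite in_itv/= => /H qc <-. Qed.

Lemma psi2_norm_mono p p' g : (p <= p')%R -> psi p g <= psi p' g.
Proof.
move=> pp'; apply: psi2_norm_le => q /andP[q1 qp]; apply: psi2_norm_ge.
by rewrite q1 (le_trans qp).
Qed.

Lemma psi2_normN p g : psi p (- g)%R = psi p g.
Proof.
congr (ereal_sup _); apply: eq_imagel => q qp; congr (_ * _).
by rewrite -oppe_Lnorm; apply: eq_Lnorm => w; exact: (congr1 EFin (opprK (g (X w)))).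
Qed.

Lemma psi2_normB p f g : psi p (f - g)%R = psi p (g - f)%R.
Proof. by rewrite -psi2_normN opprB. Qed.

Lemma psi2_norm0 p : (1 <= p)%R -> psi p 0%R = 0.
Proof.
move=> p1; apply/eqP; rewrite eq_le psi2_norm_ge0// andbT.
apply: psi2_norm_le => q /andP[q1 _].
rewrite (_ : EFin \o _ = cst 0)// Lnorm0 ?mul0e//.
by rewrite eqe gt_eqF// (lt_le_trans ltr01).
Qed.

Lemma psi2_normD p f g : V f -> V g -> psi p (f + g)%R <= psi p f + psi p g.
Proof.
move=> Vf Vg; apply: psi2_norm_le => q qp.
have /andP[q1 _] := qp.
have s0 : 0 <= ((Num.sqrt q)^-1)%:E by rewrite lee_fin invr_ge0.
apply: le_trans (leeD (psi2_norm_ge f qp) (psi2_norm_ge g qp)).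
rewrite -ge0_muleDl ?Lnorm_ge0// lee_wpmul2r//.
exact: (minkowski_EFin P (mgX Vf) (mgX Vg) q1).
Qed.

(** One bound serves all orders [q] in [[1, p]]: [|y|^q <= 1 + |y|^p] gives [E |g|^q <= B], and the
    root of order [q] is still at most [B] because [B >= 1]. *)
Lemma psi2_norm_fin_num p g : V g -> (1 <= p)%R -> psi p g \is a fin_num.
Proof.
move=> Vg p1; rewrite ge0_fin_numE; last exact: psi2_norm_ge0.
have mg := mgX Vg.
have [_ _ _ /(_ g Vg) [_ momg _]] := cV.
have := momg p p1; rewrite unlock => mp.
have mpow q : measurable_fun setT (fun w => (`|g (X w)| `^ q)%:E).
  apply/measurable_EFinP; apply: (@measurableT_comp _ _ _ _ _ _ (@powR R ^~ q)) => //.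
  exact: measurableT_comp.
pose B := 1 + \int[P]_w (`|g (X w)| `^ p)%:E.
have B1 : 1 <= B by rewrite leeDl// integral_ge0// => w _; rewrite lee_fin powR_ge0.
have Boo : B < +oo by rewrite lte_add_pinfty// ltry.
apply: le_lt_trans Boo; apply: psi2_norm_le => q /andP[q1 qp].
have q0 : (0 < q)%R by exact: lt_le_trans q1.
have NB : 'N[P]_(q%:E)[EFin \o (g \o X)] <= B.
  have : 'N[P]_(q%:E)[EFin \o (g \o X)] `^ q <= B.
    rewrite poweR_Lnorm ?gt_eqF//.
    apply: (@le_trans _ _ (\int[P]_w (1 + (`|g (X w)| `^ p)%:E))).
      apply: ge0_le_integral => //.
      - by move=> w _; rewrite poweR_ge0.
      - exact: mpow.
      - by apply: emeasurable_funD => //; exact: mpow.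
      move=> w _; rewrite /= -EFinD lee_fin; set y := `|g (X w)|%R.
      have [y1|y1] := leP y 1%R.
        have : (y `^ q <= 1 `^ q)%R.
          by rewrite ge0_ler_powR// ?nnegrE ?(ltW q0)// normr_ge0.
        by rewrite powR1 => /le_trans; apply; rewrite lerDl powR_ge0.
      by rewrite ler_wpDl// ler_powR// ltW.
    rewrite ge0_integralD//.
    by rewrite int1.
  have := Lnorm_ge0 P q%:E (EFin \o (g \o X)).
  case: ('N[P]_(q%:E)[EFin \o (g \o X)]) => [s s0|_|//]; last first.
    by rewrite poweRyr ?gt_eqF// leye_eq => /eqP ->.
  have [s1 _|s1] := leP s 1%R; first by apply: le_trans B1; rewrite lee_fin.
  rewrite poweR_EFin; apply: le_trans.
  by rewrite lee_fin -[leLHS](powRr1 s0) ler_powR// ltW.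
apply: le_trans NB; rewrite -[leRHS]mule1 lee_wpmul2l ?Lnorm_ge0// lee_fin.
rewrite invf_le1; first by rewrite -[1%R]sqrtr1 ler_wsqrtr.
by rewrite sqrtr_gt0.
Qed.

Lemma centered_integrable_exp g (c : nat) : V g ->
  P.-integrable setT (EFin \o (fun w => g (X w) ^+ c)%R).
Proof.
move=> Vg; have mg := mgX Vg.
have mgc : measurable_fun setT (EFin \o (fun w => g (X w) ^+ c)%R).
  by apply/measurable_EFinP; exact: measurable_funX.
have [_ _ _ /(_ g Vg) [_ momg _]] := cV.
case: c mgc => [|c] mgc.
  apply/integrableP; split=> //; under eq_integral do rewrite /= expr0 normr1.
  by rewrite int1 ltry.
apply/integrableP; split=> //.
have := momg c.+1%:R; rewrite ler1n unlock => /(_ isT); congr (_ < _).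
by apply: eq_integral => w _; rewrite /= powR_mulrn// normrX.
Qed.

Lemma centered_expectation g : V g -> (\int[P]_w g (X w) = 0)%R.
Proof. by have [_ _ _ H] := cV => /H[_ _]; rewrite unlock /Rintegral => ->. Qed.

(** Order [q = 2 * j] in the supremum; the tail bound uses the norm only in this form. *)
Lemma psi2_norm_even_moment g p j : V g -> (0 < j)%N -> ((2 * j)%:R <= p)%R ->
  (\int[P]_w (g (X w) ^+ (2 * j)) <=
   ((fine (psi p g)) ^+ 2 * (2 * j)%:R) ^+ j)%R.
Proof.
move=> Vg j0 jp.
have j1 : (1 <= (2 * j)%:R :> R)%R by rewrite ler1n muln_gt0.
have p1 : (1 <= p)%R by exact: le_trans jp.
have s0 : (0 < Num.sqrt (2 * j)%:R :> R)%R by rewrite sqrtr_gt0 (lt_le_trans ltr01).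
have := @psi2_norm_ge (2 * j)%:R p g; rewrite j1 jp => /(_ isT).
rewrite -[psi p g]fineK ?psi2_norm_fin_num//.
rewrite lee_pdivrMr// -EFinM => H.
have Nfin : 'N[P]_((2 * j)%:R%:E)[EFin \o (g \o X)] \is a fin_num.
  by rewrite ge0_fin_numE ?Lnorm_ge0//; apply: le_lt_trans H _; rewrite ltry.
rewrite -(fineK Nfin) lee_fin in H.
have -> : (\int[P]_w (g (X w) ^+ (2 * j)) =
    fine 'N[P]_((2 * j)%:R%:E)[EFin \o (g \o X)] ^+ (2 * j))%R.
  rewrite -powR_mulrn ?fine_ge0 ?Lnorm_ge0// -fine_poweR powR_Lnorm; last first.
    by rewrite gt_eqF// (lt_le_trans ltr01).
  congr fine; apply: eq_integral => w _; rewrite poweR_EFin powR_mulrn//.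
  by congr EFin; rewrite !exprM real_normK// num_real.
apply: le_trans (_ : _ <= (fine (psi p g) * Num.sqrt (2 * j)%:R) ^+ (2 * j))%R _.
  by rewrite lerXn2r// nnegrE ?fine_ge0 ?Lnorm_ge0// mulr_ge0// fine_ge0// psi2_norm_ge0.
by rewrite exprM [((_ * Num.sqrt _) ^+ 2)%R]exprMn sqr_sqrtr.
Qed.

End psi2_norm.

(** * Chaining *)

Section chaining_levels.
Context {R : realType}.

Lemma fset_set_card_le (U : choiceType) (A : set U) m :
  (A #<= `I_m)%card -> (#|` fset_set A| <= m)%N.
Proof.
move=> Am; have [k Ak] : finite_set A by exact: card_le_finite Am (finite_II m).
by rewrite (card_fset_set Ak) -card_le_II -(card_le_eql Ak).
Qed.

(** Base 2 is relaxed to [e] so that cardinalities can be set against tails [expR (- p)]. Levels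
    [l <= 0] hold the single point 0. *)
Lemma extend_seq_card_le d' (T : measurableType d') (A : set (T -> R))
    (As : nat -> set (T -> R)) l :
  admissible A As ->
  (#|` fset_set (extend_seq As l)|%:R <= expR (2 ^ l) :> R)%R.
Proof.
move=> [_ _ As0 cAs].
have h0 : (#|` fset_set [set 0 : T -> R]|%:R <= expR (2 ^ l) :> R)%R.
  rewrite fset_set1 cardfs1; apply: (le_trans _ (expR_ge1Dx _)).
  by rewrite lerDl exprz_ge0.
case: l h0 => [[|i]|i] h0 //=; first by rewrite As0.
apply: le_trans (_ : (2 ^ (2 ^ i.+1))%N%:R <= _)%R.
  by rewrite ler_nat; apply: fset_set_card_le; exact: cAs.
rewrite natrX -[X in expR X]mulr1 (_ : (2 ^ i.+1 = (2 ^ i.+1)%N%:R :> R)%R);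
  last by rewrite natrX.
by rewrite expRM_natl lerXn2r// ?nnegrE ?expR_ge0// expR1_ge2.
Qed.

Lemma floor_log2_bounds (r : R) : (0 < r)%R ->
  (r / 6 <= (2 : R) ^ (Num.floor (ln (r / 3) / ln 2)) <= r / 3)%R.
Proof.
move=> r0; have r3 : (0 < r / 3)%R by rewrite divr_gt0.
have ln2 : (0 < ln 2 :> R)%R by rewrite ln_gt0// ltr1n.
have pl (a b : R) : (a <= b -> 2 `^ a <= 2 `^ b)%R.
  by move=> ab; rewrite ler_powR// ler1n.
have r3E : (2 `^ (ln (r / 3) / ln 2) = r / 3)%R.
  by rewrite /powR pnatr_eq0/= divfK ?gt_eqF// lnK.
have /andP[h1 /ltW h2] := floor_itv (ln (r / 3) / ln 2)%R.
have /pl := h1; rewrite r3E powR_intmul// => ->; rewrite andbT.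
have /pl := h2; rewrite r3E powR_intmul// expfzDr// expr1z.
by move: (2 ^ _)%R => u; lra.
Qed.

End chaining_levels.

(** * Union bound over finitely many functions *)

Section union_tail.
Context {R : realType} {d d' : measure_display}.
Context {Omega : measurableType d} {T : measurableType d'}.
Variables (P : probability Omega R) (X : {RV P >-> T}) (V : set (T -> R)).
Variables (n : nat) (Xs : 'I_n -> {RV P >-> T}).
Hypotheses (cV : centered_moment_space X V) (iidX : iid_copies X Xs).
Hypothesis n0 : (0 < n)%N.

(** The level that the empirical mean of [g] exceeds with probability at most [expR (- p)], by
    [psi2_tail]. *)
Definition tail_level (p : R) (g : T -> R) : R :=
  (4 * expR 1 * Num.sqrt (p / n%:R) * fine (psi2_norm X p g))%R.

Lemma psi2_tail p g : V g -> (2 <= p)%R ->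
  P [set w | (tail_level p g < empirical_mean Xs g w)%R] <= (expR (- p))%:E.
Proof.
move=> Vg p2; apply: (iid_mean_tail iidX) => //.
- exact: (centered_measurable cV).
- by move=> c; exact: (centered_integrable_exp cV).
- by rewrite fine_ge0// psi2_norm_ge0//; lra.
- exact: (centered_expectation cV).
- by move=> j j0 jp; exact: (psi2_norm_even_moment cV).
Qed.

(** Each function carries its own moment order, since the groups in the union bound use different
    orders. *)
Definition tail_good (L : seq (R * (T -> R))) : set Omega :=
  [set w | forall x, x \in L -> (empirical_mean Xs x.2 w <= tail_level x.1 x.2)%R].

Lemma tail_good_prob (L : seq (R * (T -> R))) :
  (forall x, x \in L -> (2 <= x.1)%R /\ V x.2) ->
  measurable (tail_good L) /\
  P (~` tail_good L) <= (\sum_(x <- L) expR (- x.1))%:E.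
Proof.
elim: L => [|x L IH] HL.
  have -> : tail_good [::] = setT by apply/seteqP; split.
  by rewrite setCT measure0 big_nil; split.
have /IH[mL PL] : forall y, y \in L -> (2 <= y.1)%R /\ V y.2.
  by move=> y yL; apply: HL; rewrite inE yL orbT.
have [x2 Vx] := HL x (mem_head _ _).
pose B := [set w | (tail_level x.1 x.2 < empirical_mean Xs x.2 w)%R].
have mB : measurable B.
  by apply: measurable_empirical_gt; exact: (centered_measurable cV).
have E : ~` tail_good (x :: L) = B `|` ~` tail_good L.
  apply/seteqP; split => w.
    move=> ng; have [Bw|nB] := pselect (B w); [by left|right=> gL; apply: ng].
    move=> y; rewrite inE => /predU1P[->|/gL//].
    by rewrite leNgt; apply/negP.
  move=> [Bw|ng] gxL; last by apply: ng => y yL; apply: gxL; rewrite inE yL orbT.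
  by have := gxL x (mem_head _ _); rewrite leNgt Bw.
split.
  rewrite -[tail_good _]setCK E; apply: measurableC; apply: measurableU => //.
  exact: measurableC.
rewrite E big_cons EFinD.
apply: (le_trans (measureU2 P mB (measurableC mL))).
by apply: leeD => //; exact: psi2_tail.
Qed.

End union_tail.

(** * Failure probabilities and weighted sums along the chain *)

Section chaining_numerics.
Context {R : realType}.
Local Open Scope ring_scope.

Lemma half_exp_bound (x : R) j : (j + 2)%:R <= x -> expR (- x) <= 2^-1 ^+ (j + 2).
Proof.
move=> jx; apply: (@le_trans _ _ (expR (- (j + 2)%:R))).
  by rewrite ler_expR lerN2.
rewrite -[X in expR (- X)]mulr1 -mulrN expRM_natl expRN lerXn2r//.
- by rewrite nnegrE invr_ge0 expR_ge0.
- by rewrite nnegrE.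
- by rewrite lef_pV2 ?posrE ?expR_gt0// expR1_ge2.
Qed.

(** With [u = 2^l0], the first term is for at most [expR u] starting points at order [2r + 1], and
    index [j] for the pairs of neighbouring levels at order [2^(l0 + j + 4)]. They take one half and
    the fraction [2^-(j + 2)] of [expR (- r)]. *)
Lemma chain_prob_sum_le (u r : R) N : 2 <= r -> r / 6 <= u <= r / 3 ->
  expR u * expR (- (2 * r + 1)) +
  \sum_(j < N.+1) expR (u * 2 ^+ j.+1) * expR (u * 2 ^+ j) *
    expR (- (16 * (u * 2 ^+ j))) <= expR (- r).
Proof.
move=> r2 /andP[u1 u2].
have a1 : expR u * expR (- (2 * r + 1)) <= expR (- r) * 2^-1.
  apply: (@le_trans _ _ (expR (- r) * expR (- 1))).
    by rewrite -!expRD ler_expR; lra.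
  rewrite ler_wpM2l ?expR_ge0// expRN lef_pV2 ?posrE ?expR_gt0//; exact: expR1_ge2.
(* The total exponent is [- 13 * u * 2^j <= - (13/6) * r * 2^j]; splitting [13/6 = 1 + 7/6] and
   using [2^j >= 1] and [r >= 2] leaves [- r - (7/3) * 2^j]. *)
have a2 j : expR (u * 2 ^+ j.+1) * expR (u * 2 ^+ j) *
    expR (- (16 * (u * 2 ^+ j))) <= expR (- r) * 2^-1 ^+ (j + 2).
  have [v1 v2] : 1 <= 2 ^+ j :> R /\ (j.+1)%:R <= 2 ^+ j :> R.
    by rewrite -natrX ler1n ler_nat expn_gt0 ltn_expl.
  apply: (@le_trans _ _ (expR (- r) * expR (- (7 / 3 * 2 ^+ j)))).
    rewrite -!expRD ler_expR exprS.
    have h1 : r / 6 * 2 ^+ j <= u * 2 ^+ j by rewrite ler_wpM2r ?exprn_ge0.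
    have h2 : r * 1 <= r * 2 ^+ j by rewrite ler_wpM2l//; lra.
    have h3 : 2 * 2 ^+ j <= r * 2 ^+ j by rewrite ler_wpM2r ?exprn_ge0.
    move: h1 h2 h3; rewrite mulrAC mulr1 [u * (2 * _)]mulrCA.
    by move: (r * 2 ^+ j) (u * 2 ^+ j) (2 ^+ j) v1 => x y z; lra.
  rewrite ler_wpM2l ?expR_ge0// half_exp_bound//.
  by move: v2; rewrite natrD -natr1; move: (2 ^+ j) => z; have := ler0n R j; lra.
apply: (@le_trans _ _ (expR (- r) * 2^-1 +
    \sum_(j < N.+1) expR (- r) * 2^-1 ^+ (j + 2))).
  by rewrite lerD// ler_sum.
rewrite -mulr_sumr -mulrDr ger_pMr ?expR_gt0//.
suff -> : \sum_(i < N.+1) 2^-1 ^+ (i + 2) = 2^-1 - 2^-1 ^+ (N + 2) :> R.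
  have : 0 <= 2^-1 ^+ (N + 2) :> R by rewrite exprn_ge0.
  lra.
elim: N => [|N IH]; first by rewrite big_ord1 !add0n !exprS expr0; field.
by rewrite big_ord_recr/= IH addSn exprS; field.
Qed.

(** Three copies of one sum: its term [j = 0] covers the starting point, and the triangle inequality
    on the links gives two more. The shifted copy is absorbed because the weights [v] increase and
    [D N.+1 = 0]. *)
Lemma chain_sum_le (N : nat) (v D : nat -> R) : (forall j, 0 <= v j) ->
  (forall j, v j <= v j.+1) -> (forall j, 0 <= D j) -> D N.+1 = 0 ->
  v 0%N * D 0%N + \sum_(j < N.+1) v j * (D j + D j.+1) <=
  3 * \sum_(j < N.+1) v j * D j.
Proof.
move=> v0 vmono D0 DN.
under eq_bigr do rewrite mulrDr.
rewrite big_split/=.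
have h1 : v 0%N * D 0%N <= \sum_(j < N.+1) v j * D j.
  by rewrite big_ord_recl lerDl sumr_ge0// => j _; rewrite mulr_ge0.
have h2 : \sum_(j < N.+1) v j * D j.+1 <= \sum_(j < N.+1) v j * D j.
  apply: (@le_trans _ _ (\sum_(j < N.+2) v j * D j)).
    rewrite [leRHS]big_ord_recl; apply: ler_wpDl; first by rewrite mulr_ge0.
    by apply: ler_sum => j _; rewrite ler_wpM2r// vmono.
  by rewrite big_ord_recr/= DN mulr0 addr0.
lra.
Qed.

Lemma seq_argmin (U : eqType) (f : U -> \bar R) (s : seq U) x0 : x0 \in s ->
  exists2 x, x \in s & forall y, y \in s -> (f x <= f y)%E.
Proof.
elim: s x0 => // x s IH x0 _; case: s IH => [_|y s IH].
  by exists x => [|y]; rewrite ?inE// => /eqP ->.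
have [z zs hz] := IH y (mem_head _ _).
have [xz|zx] := leP (f x) (f z).
  exists x; first exact: mem_head.
  by move=> t; rewrite inE => /predU1P[->//|/hz]; exact: le_trans.
exists z; first by rewrite inE zs orbT.
by move=> t; rewrite inE => /predU1P[->|/hz//]; exact: ltW.
Qed.

Lemma sum_expR_const (U : eqType) (s : seq (R * U)) p :
  (forall x, x \in s -> x.1 = p) ->
  \sum_(x <- s) expR (- x.1) = (size s)%:R * expR (- p).
Proof.
move=> H; rewrite (eq_big_seq (fun=> expR (- p))); last by move=> x /H ->.
by rewrite big_const_seq count_predT iter_addr_0 mulr_natl.
Qed.

End chaining_numerics.

(** * Norms, means and weights along a chain *)

Section chain.
Context {R : realType} {d d' : measure_display}.
Context {Omega : measurableType d} {T : measurableType d'}.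
Variables (P : probability Omega R) (X : {RV P >-> T}) (V : set (T -> R)).
Variables (n : nat) (Xs : 'I_n -> {RV P >-> T}).
Hypothesis cV : centered_moment_space X V.
Local Notation kn p g := (fine (psi2_norm X p g)).
Local Notation emp := (empirical_mean Xs).

Lemma fine_psi2_ge0 p g : (1 <= p)%R -> (0 <= kn p g)%R.
Proof. by move=> p1; rewrite fine_ge0// psi2_norm_ge0. Qed.

Lemma fine_psi2_mono p p' g : V g -> (1 <= p)%R -> (p <= p')%R ->
  (kn p g <= kn p' g)%R.
Proof.
move=> Vg p1 pp'; have p'1 := le_trans p1 pp'.
by rewrite fine_le ?(psi2_norm_fin_num cV)// psi2_norm_mono.
Qed.

Lemma fine_psi2_triangle p a x y : V a -> V x -> V y -> (1 <= p)%R ->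
  (kn p (x - y)%R <= kn p (a - y)%R + kn p (a - x)%R)%R.
Proof.
move=> Va Vx Vy p1; have Vsub := centered_sub cV.
rewrite -fineD ?(psi2_norm_fin_num cV)//; try exact: Vsub.
rewrite fine_le ?fin_numD ?(psi2_norm_fin_num cV)//; try exact: Vsub.
rewrite (psi2_normB X p a x); apply: le_trans (psi2_normD cV _ _ _).
- by rewrite (_ : a - y + (x - a) = x - y)%R// addrC addrA subrK.
- exact: Vsub.
- exact: Vsub.
Qed.

Lemma empirical_meanB (f g : T -> R) w : (emp (f - g) w = emp f w - emp g w)%R.
Proof.
rewrite /empirical_mean -mulrBr -sumrB; congr (_ * _)%R.
Qed.

(** Origin of the weights in [gamma_flat]: order [2^(l + 4)] turns the factor [sqrt (p / n)] of the
    tail bound into [2^(l/2)], with [sqrt (2^4) = 4] going into the constant. *)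
Lemma sqrt_exprz_div (l : int) :
  (Num.sqrt (2 ^ (l + 4) / n%:R) = 4 * 2 `^ (l%:~R / 2) / Num.sqrt n%:R :> R)%R.
Proof.
have v0 : (0 <= 2 `^ (l%:~R / 2) :> R)%R by exact: powR_ge0.
have E : (2 ^ (l + 4) = (4 * 2 `^ (l%:~R / 2)) ^+ 2 :> R)%R.
  rewrite exprMn (expr2 (_ `^ _)) -powRD ?pnatr_eq0 ?implybT//.
  rewrite -splitr powR_intmul// expfzDr// (_ : 2 ^ 4%Z = 16)%R; first by ring.
  by rewrite -[4%Z]/(4%N%:Z) -exprnP; ring.
rewrite E sqrtrM ?sqr_ge0// sqrtr_sqr ger0_norm ?mulr_ge0// sqrtrV//.
Qed.

Lemma measurable_empirical_le (F : set (T -> R)) (c : (T -> R) -> R) :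
  F `<=` V -> finite_set F ->
  measurable [set w | forall f, F f -> (emp f w <= c f)%R].
Proof.
move=> FV finF.
rewrite (_ : [set w | _] = \bigcap_(f in F) ~` [set w | (c f < emp f w)%R]).
  apply: fin_bigcap_measurable => // f Ff; apply: measurableC.
  by apply: measurable_empirical_gt; apply: (centered_measurable cV); exact: FV.
apply/seteqP; split => w H f Ff /=.
  by apply/negP; rewrite -leNgt; exact: H.
by rewrite leNgt; apply/negP; exact: H.
Qed.

Lemma sum_le_esum_int (l0 : int) (N : nat) (a : int -> \bar R) :
  \sum_(j < N.+1) a (l0 + j%:Z)%R <= \esum_(l in [set l : int | (l0 <= l)%R]) a l.
Proof.
apply: esum_ge; exists ((fun j : nat => (l0 + j%:Z)%R) @` `I_N.+1).
  split; first exact: finite_image.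
  by move=> _ [j _ <-] /=; rewrite lerDl.
rewrite (fsbig_ord _ _ (fun j : nat => a (l0 + j%:Z)%R)).
rewrite (reindex_fsbig (fun j : nat => (l0 + j%:Z)%R) `I_N.+1)//.
split; [by move=> j jN; exists j| |by move=> _ [j jN <-]; exists j].
by move=> i j _ _ /addrI [].
Qed.

End chain.

(** * Chaining along a fixed admissible sequence *)

Section chaining_fixed.
Context {R : realType} {d d' : measure_display}.
Context {Omega : measurableType d} {T : measurableType d'}.
Variables (P : probability Omega R) (X : {RV P >-> T}) (V F : set (T -> R)).
Variables (n : nat) (Xs : 'I_n -> {RV P >-> T}).
Variables (A : (T -> R) -> (T -> R)) (k : nat) (r : R).
Hypotheses (cV : centered_moment_space X V) (iidX : iid_copies X Xs).
Hypotheses (n0 : (0 < n)%N) (FV : F `<=` V) (finF : finite_set F).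
Hypotheses (FA : forall f, F f -> F (A f)) (r2 : (2 <= r)%R).
Hypothesis Acontract : forall f, F f ->
  psi2_norm X (r + k%:R)%R (A f) <= psi2_norm X (r + k%:R)%R f.
Hypothesis cardA : (#|` fset_set (A @` F)|%:R <= expR k%:R :> R)%R.
Local Notation kn p g := (fine (psi2_norm X p g)).
Local Notation emp := (empirical_mean Xs).
Local Notation tail := (tail_level X n).

Let calA := [set (f - A f)%R | f in F].
(** This is [-1] when [r < 3], so levels are written [l0 + j] with [j] natural. *)
Let l0 : int := Num.floor (ln (r / 3) / ln 2)%R.
Let u : R := (2 ^ l0)%R.
Let q (j : nat) : R := (2 ^ (l0 + j%:Z + 4))%R.
Let v (j : nat) : R := (2 `^ ((l0 + j%:Z)%:~R / 2))%R.

Let u_bounds : (r / 6 <= u <= r / 3)%R.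
Proof. by apply: floor_log2_bounds; exact: lt_le_trans r2. Qed.

Let uj j : (2 ^ (l0 + j%:Z) = u * 2 ^+ j :> R)%R.
Proof. by rewrite expfzDr. Qed.

Let qE j : (q j = 16 * (u * 2 ^+ j))%R.
Proof.
rewrite /q expfzDr// uj mulrC (_ : 2 ^ 4%Z = 16)%R//.
by rewrite -[4%Z]/(4%N%:Z) -exprnP; ring.
Qed.

(** The smallest order is [16 * u >= (8/3) * r]. So norms of order [2r + 1] are dominated by those
    of every level of the chain. *)
Let q_lb j : (2 * r + 1 <= q j)%R.
Proof.
have /andP[u1 _] := u_bounds.
have u0 : (0 <= u)%R by exact: exprz_ge0.
have h : (u <= u * 2 ^+ j)%R by rewrite ler_peMr// exprn_ege1// ler1n.
rewrite qE; move: (le_trans u1 h) r2; move: (u * 2 ^+ j)%R => z; lra.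
Qed.

Let calAV : calA `<=` V.
Proof. by move=> _ [f Ff <-]; apply: (centered_sub cV); apply: FV => //; exact: FA. Qed.

Let fin_calA : finite_set calA.
Proof. exact: finite_image. Qed.

Variable As : nat -> set (T -> R).
Hypothesis adm : admissible calA As.

(* The chain stops at level [l0 + N], after which all of [calA] is used; [N] is
   large enough for [#|calA| <= expR (2 ^ (l0 + N + 1))], so that the last links
   obey the same cardinality bound as the others. *)
Let N := (3 * #|` fset_set calA|)%N.
Let ext j := extend_seq As (l0 + j%:Z).
Let B j : seq (T -> R) :=
  if (j <= N)%N then fset_set (ext j) : seq _ else fset_set calA : seq _.

Let As0 i : As i 0%R.
Proof.
have [_ incr e0 _] := adm.
by elim: i => [|i IH]; [rewrite e0|exact: incr].
Qed.

Let ext_sub j : ext j `<=` calA.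
Proof.
have [sub _ _ _] := adm; rewrite /ext; case: (l0 + _)%R => [i|i] /=.
  exact: sub.
by move=> _ ->; apply: (sub 0%N); exact: As0.
Qed.

Let ext0 j : ext j 0%R.
Proof. by rewrite /ext; case: (l0 + _)%R => [i|i] //=; exact: As0. Qed.

Let fin_ext j : finite_set (ext j).
Proof. exact: sub_finite_set (@ext_sub j) fin_calA. Qed.

Let BE j x : (j <= N)%N -> (x \in B j) = (x \in ext j).
Proof. by move=> jN; rewrite /B jN in_fset_set. Qed.

Let B_sub j x : x \in B j -> calA x.
Proof.
rewrite /B; case: ifP => _; rewrite in_fset_set// => /set_mem//; exact: ext_sub.
Qed.

(** Up to level [N] this is admissibility. At [j = N.+1], [u >= 1/3] because [r >= 2], so
    [u * 2^(N + 1) >= (N + 1) / 3], which exceeds the cardinality of [calA]; hence the 3 in [N]. *)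
Let sizeB j : (j <= N.+1)%N -> ((size (B j))%:R <= expR (u * 2 ^+ j) :> R)%R.
Proof.
rewrite leq_eqVlt => /predU1P[->|]; last first.
  rewrite ltnS /B => ->; rewrite -uj; exact: (extend_seq_card_le _ adm).
rewrite /B ltnn; apply: le_trans (expR_ge1Dx _).
have /andP[u1 _] := u_bounds.
have : (3^-1 * (N.+1)%:R <= u * 2 ^+ N.+1)%R.
  rewrite ler_pM//; first by have := r2; lra.
  by rewrite -natrX ler_nat ltnW// ltn_expl.
have -> : (N.+1%:R = 3 * #|` fset_set calA|%:R + 1 :> R)%R.
  by rewrite -[N.+1]addn1 natrD natrM.
by move: (u * _)%R (#|` fset_set calA|%:R)%R => y z; lra.
Qed.

Let L1 : seq (R * (T -> R)) := [seq ((r + k%:R)%R, a) | a <- fset_set (A @` F)].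
Let L2 : seq (R * (T -> R)) := [seq ((2 * r + 1)%R, b) | b <- B 0].
Let L3 j : seq (R * (T -> R)) :=
  [seq (q j, (x - y)%R) | x <- B j.+1, y <- B j].
Let L := L1 ++ L2 ++ flatten [seq L3 j | j <- iota 0 N.+1].

Let L_valid x : x \in L -> (2 <= x.1)%R /\ V x.2.
Proof.
rewrite 2!mem_cat => /or3P[/mapP[a aA ->]|/mapP[b bB ->]|/flattenP[_ /mapP[j _ ->]]] /=.
- split; first by rewrite (le_trans r2)// lerDl.
  move: aA; rewrite in_fset_set; last exact: finite_image.
  by move=> /set_mem[f Ff <-]; exact/FV/FA.
- by split; [have := r2; lra|exact/calAV/(B_sub bB)].
- move=> /allpairsP[[y z] [/= yB zB ->]] /=; split.
    by apply: le_trans (q_lb j); have := r2; lra.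
  by apply: (centered_sub cV); apply: calAV; [exact: B_sub yB|exact: B_sub zB].
Qed.

(** [L1] costs [e^k * e^-(r + k) = e^-r]; the starting points [L2] and the links [L3] share a second
    [e^-r]. *)
Let L_sum : (\sum_(x <- L) expR (- x.1) <= 2 * expR (- r))%R.
Proof.
rewrite 2!big_cat (_ : 2 * expR (- r) = expR (- r) + expR (- r))%R; last by ring.
apply: lerD.
  rewrite (sum_expR_const (p := (r + k%:R)%R)); last by move=> x /mapP[a _ ->].
  rewrite size_map; apply: (@le_trans _ _ (expR k%:R * expR (- (r + k%:R)))%R).
    by rewrite ler_wpM2r// expR_ge0.
  by rewrite -expRD (_ : k%:R - (r + k%:R) = - r)%R//; ring.
apply: le_trans (chain_prob_sum_le N r2 u_bounds).
apply: lerD.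
  rewrite (sum_expR_const (p := (2 * r + 1)%R)); last by move=> x /mapP[a _ ->].
  rewrite size_map ler_wpM2r ?expR_ge0//.
  by have := sizeB (leq0n N.+1); rewrite expr0 mulr1.
rewrite big_flatten big_map -{1}[N.+1]subn0 -/(index_iota 0 N.+1) big_mkord.
apply: ler_sum => j _.
rewrite (sum_expR_const (p := q j)); last by move=> x /allpairsP[y [_ _ ->]].
rewrite size_allpairs -qE ler_wpM2r ?expR_ge0// natrM ler_pM// sizeB//.
by rewrite ltnW// ltnS ltnW.
Qed.


Let q1 j : (1 <= q j)%R.
Proof. by apply: le_trans (q_lb j); have := r2; lra. Qed.

Let v_mono j : (v j <= v j.+1)%R.
Proof.
rewrite ler_powR ?ler1n// ler_wpM2r ?invr_ge0// ler_int lerD2l.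
by rewrite lez_nat.
Qed.

(** The infimum defining [psi2_dist] is attained on the finite list [B j]; beyond level [N] the
    chain has reached [a]. *)
Let nearest (a : T -> R) j : exists x : T -> R, calA a ->
  [/\ x \in B j,
    (j <= N)%N -> (kn (q j) (a - x)%R)%:E <= psi2_dist X (q j) a (ext j) &
    (N < j)%N -> x = a].
Proof.
have [Aa|] := pselect (calA a); last by exists a.
case: (leqP j N) => jN; last first.
  exists a => _; split => //.
  by rewrite /B leqNgt jN/= in_fset_set// mem_set.
have B0 : 0%R \in B j by rewrite BE// mem_set.
have [x xB hx] := seq_argmin (fun x => psi2_norm X (q j) (a - x)%R) B0.
exists x => _; split => //.
move=> _; apply: le_ereal_inf_tmp => z [h hext <-].
rewrite fineK; last first.
  apply: (psi2_norm_fin_num cV) => //; apply: (centered_sub cV); apply: calAV => //.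
  exact: B_sub xB.
by apply: hx; rewrite BE// mem_set.
Qed.

(** On the good event [f] is written as [A f], plus the starting point [pi 0], plus the links, each
    with a controlled mean. The constant is [48 = 4 * 4 * 3]: the tail bound, [sqrt (2^4)], and
    [chain_sum_le]. *)
Lemma chain_deterministic (w : Omega) (y : R) : tail_good X Xs L w ->
  (forall a, calA a ->
    \esum_(l in [set l : int | (l0 <= l)%R]) (2 `^ (l%:~R / 2))%R%:E *
      psi2_dist X (2 ^ (l + 4))%R a (extend_seq As l) <= y%:E) ->
  forall f, F f -> (emp f w <= tail (r + k%:R) f + tail (2 * r + 1) (f - A f) +
    48 * expR 1 / Num.sqrt n%:R * y)%R.
Proof.
move=> good Hy f Ff; set a := (f - A f)%R.
have Aa : calA a by exists f.
have [pi Hpi] := choice (nearest a).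
have piB j : pi j \in B j by have [] := Hpi j Aa.
have pid j : (j <= N)%N ->
    (kn (q j) (a - pi j)%R)%:E <= psi2_dist X (q j) a (ext j).
  by have [] := Hpi j Aa.
have piN : pi N.+1 = a by have [_ _] := Hpi N.+1 Aa; exact.
have piV j : V (pi j) by apply: calAV; exact: B_sub (piB j).
have aV : V a by exact: calAV.
(* Cut off to 0 beyond [N], in agreement with [pi N.+1 = a]. *)
pose D j : R := if (j <= N)%N then kn (q j) (a - pi j)%R else 0%R.
have D0 j : (0 <= D j)%R.
  by rewrite /D; case: ifP => // _; exact: fine_psi2_ge0.
have DN : D N.+1 = 0%R by rewrite /D ltnn.
have v0 j : (0 <= v j)%R by exact: powR_ge0.
have sqn : (0 < Num.sqrt n%:R :> R)%R by rewrite sqrtr_gt0 ltr0n.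
pose C := (16 * expR 1 / Num.sqrt n%:R : R)%R.
have C0 : (0 <= C)%R by rewrite divr_ge0// mulr_ge0// expR_ge0.
have tailE j g : (tail (q j) g = C * (v j * kn (q j) g))%R.
  by rewrite /tail_level /q sqrt_exprz_div /C /v; ring.
have sumD : (\sum_(j < N.+1) v j * D j <= y)%R.
  rewrite -lee_fin; apply: le_trans (Hy a Aa).
  pose G l := (2 `^ (l%:~R / 2))%R%:E * psi2_dist X (2 ^ (l + 4))%R a (extend_seq As l).
  apply: le_trans (sum_le_esum_int l0 N G).
  rewrite -sumEFin; apply: lee_sum => j _.
  have jN : (j <= N)%N by rewrite -ltnS.
  by rewrite EFinM /D jN /G lee_wpmul2l ?lee_fin//; exact: pid.
have step (j : 'I_N.+1) : (emp (pi j.+1 - pi j) w <= C * (v j * (D j + D j.+1)))%R.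
  have jN : (j <= N)%N by rewrite -ltnS.
  have jL : (q j, (pi j.+1 - pi j)%R) \in L.
    rewrite 2!mem_cat; apply/or3P; apply: Or33; apply/flattenP; exists (L3 j).
      by apply/mapP; exists (nat_of_ord j) => //; rewrite mem_iota ltn_ord.
    by apply/allpairsP; exists (pi j.+1, pi j); split => //=.
  apply: le_trans (good _ jL) _; rewrite /= tailE.
  rewrite ler_wpM2l// ler_wpM2l//.
  apply: le_trans (fine_psi2_triangle cV aV (piV _) (piV _) (q1 j)) _.
  (* [D j.+1] is measured at the larger order [q j.+1], which monotonicity of the norm allows; at
     [j = N] the second distance is that from [a] to itself. *)
  rewrite /D jN lerD2l; case: (ltnP j N) => jN'.
    apply: (fine_psi2_mono cV) => //.
    - exact: (centered_sub cV).
    - by rewrite !qE ler_wpM2l// ler_wpM2l ?exprz_ge0// ler_weXn2l// ler1n.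
  have -> : nat_of_ord j = N by apply/eqP; rewrite eqn_leq jN jN'.
  by rewrite piN subrr psi2_norm0.
(* The norm of the starting point is at most that of [a] plus its distance to [a]. The first stays
   in the statement; the second is raised to order [q 0] and joins the chain sum as [D 0]. *)
have base : (emp (pi 0%N) w <= tail (2 * r + 1) a + C * (v 0%N * D 0%N))%R.
  have r1 : (1 <= 2 * r + 1)%R by have := r2; lra.
  have jL : ((2 * r + 1)%R, pi 0%N) \in L.
    by rewrite 2!mem_cat; apply/or3P; apply: Or32; apply/mapP; exists (pi 0%N).
  apply: le_trans (good _ jL) _; rewrite /=.
  have -> : (C * (v 0%N * D 0%N) = tail (q 0%N) (a - pi 0%N))%R by rewrite tailE.
  have V0 : V 0%R by have [] := cV.
  have Vd : V (a - pi 0%N)%R by exact: (centered_sub cV).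
  have := fine_psi2_triangle cV aV (piV 0%N) V0 r1; rewrite !subr0 => tri.
  rewrite /tail_level; apply: le_trans (ler_wpM2l _ tri) _.
    by rewrite !mulr_ge0// expR_ge0.
  rewrite mulrDr lerD2l ler_pM//.
  - exact: fine_psi2_ge0.
  - rewrite ler_wpM2l ?mulr_ge0 ?expR_ge0// ler_wsqrtr// ler_wpM2r ?invr_ge0//.
  - by apply: (fine_psi2_mono cV) => //; exact: q_lb.
have telescope : (emp a w = emp (pi 0%N) w +
    \sum_(j < N.+1) emp (pi j.+1 - pi j) w)%R.
  under eq_bigr do rewrite empirical_meanB.
  rewrite -(big_mkord xpredT (fun j => emp (pi j.+1) w - emp (pi j) w)%R).
  by rewrite telescope_sumr// piN addrC subrK.
have fE : (emp f w = emp (A f) w + emp a w)%R by rewrite /a empirical_meanB addrC subrK.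
have hA : (emp (A f) w <= tail (r + k%:R) f)%R.
  have jL : ((r + k%:R)%R, A f) \in L.
    rewrite mem_cat; apply/orP; left; apply/mapP; exists (A f) => //.
    by rewrite in_fset_set ?mem_set//; exact: finite_image.
  apply: le_trans (good _ jL) _; rewrite /= /tail_level.
  have p1 : (1 <= r + k%:R)%R by have := r2; have := ler0n R k; lra.
  rewrite ler_wpM2l ?mulr_ge0 ?expR_ge0// fine_le ?(psi2_norm_fin_num cV)//.
  - exact/FV/FA.
  - exact/FV.
  - exact: Acontract.
rewrite fE telescope -addrA lerD//.
apply: le_trans (lerD base (ler_sum _ (fun j _ => step j))) _.
rewrite -addrA lerD2l -mulr_sumr -mulrDr.
apply: le_trans (_ : C * (3 * \sum_(j < N.+1) v j * D j) <= _)%R.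
  by rewrite ler_wpM2l// chain_sum_le.
apply: le_trans (_ : C * (3 * y) <= _)%R.
  by rewrite ler_wpM2l// ler_wpM2l.
by rewrite /C le_eqVlt; apply/orP; left; apply/eqP; ring.
Qed.

Lemma chaining_prob (y : R) :
  (forall a, calA a ->
    \esum_(l in [set l : int | (l0 <= l)%R]) (2 `^ (l%:~R / 2))%R%:E *
      psi2_dist X (2 ^ (l + 4))%R a (extend_seq As l) <= y%:E) ->
  (1 - 2 * expR (- r))%R%:E <= P [set w | forall f, F f -> (emp f w <=
    tail (r + k%:R) f + tail (2 * r + 1) (f - A f) +
    48 * expR 1 / Num.sqrt n%:R * y)%R].
Proof.
move=> Hy; have [mG PG] := tail_good_prob cV iidX n0 L_valid.
apply: (@le_trans _ _ (P (tail_good X Xs L))); last first.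
  apply: le_measure; rewrite ?inE//.
    exact: (measurable_empirical_le Xs cV (fun f => tail (r + k%:R) f +
      tail (2 * r + 1) (f - A f) + 48 * expR 1 / Num.sqrt n%:R * y)%R FV finF).
  by move=> w good; exact: chain_deterministic.
move: PG; rewrite probability_setC//.
have /fineK <- : P (tail_good X Xs L) \is a fin_num by rewrite fin_num_measure.
by move: (fine _) => z; have := L_sum; rewrite -EFinB !lee_fin; lra.
Qed.

End chaining_fixed.

(** * Passage to the infimum over admissible sequences *)

Lemma gamma_flat_ge0 (R : realType) (d d' : measure_display)
    (Omega : measurableType d) (T : measurableType d') (P : probability Omega R)
    (X : {RV P >-> T}) (A : set (T -> R)) (l0 : int) :
  A !=set0 -> 0 <= gamma_flat X A l0.
Proof.
move=> [a Aa]; apply: le_ereal_inf_tmp => x [As _ <-].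
apply: le_trans (ereal_sup_ubound _); last by exists a.
apply: esum_ge; exists set0; first by split.
by rewrite fsbig_set0.
Qed.

Theorem corollary1 (R : realType) :
  exists C : R, (0 < C)%R /\
  forall (d d' : measure_display)
    (Omega : measurableType d) (T : measurableType d')
    (P : probability Omega R)
    (X : {RV P >-> T}) (n : nat) (Xs : 'I_n -> {RV P >-> T})
    (V F : set (T -> R)) (A : (T -> R) -> (T -> R)) (k : nat) (r : R),
  (0 < n)%N ->
  iid_copies X Xs ->
  centered_moment_space X V ->
  F `<=` V -> finite_set F -> F 0%R ->
  (forall f, F f -> F (A f)) ->
  (2 <= r)%R ->
  (forall f, F f ->
     psi2_norm X (r + k%:R)%R (A f) <= psi2_norm X (r + k%:R)%R f) ->
  (#|` fset_set (A @` F)|%:R <= expR k%:R :> R)%R ->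
  let calA := [set (f - A f)%R | f in F] in
  let l0 : int := Num.floor (ln (r / 3) / ln 2)%R in
  (1 - 2 * expR (- r))%R%:E <=
  P [set w | forall f, F f ->
       (empirical_mean Xs f w)%:E
       - (4 * expR 1 * Num.sqrt ((r + k%:R) / n%:R))%R%:E
         * psi2_norm X (r + k%:R)%R f
       - (4 * expR 1 * Num.sqrt ((2 * r + 1) / n%:R))%R%:E
         * psi2_norm X (2 * r + 1)%R (f - A f)%R
       <= C%:E * (gamma_flat X calA l0 * ((Num.sqrt n%:R)^-1)%:E)].
Proof.
exists (48 * expR 1)%R; split; first by rewrite mulr_gt0// expR_gt0.
move=> d d' Omega T P X n Xs V F A k r n0 iidX cV FV finF F0 FA r2 Acon cardA.
cbv zeta; set calA := [set (f - A f)%R | f in F].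
set l0 := Num.floor (ln (r / 3) / ln 2)%R.
have sqn : (0 < Num.sqrt n%:R :> R)%R by rewrite sqrtr_gt0 ltr0n.
have C0 : (0 < 48 * expR 1 :> R)%R by rewrite mulr_gt0// expR_gt0.
have K0 : (0 < 48 * expR 1 / Num.sqrt n%:R :> R)%R by rewrite divr_gt0.
pose c f := (tail_level X n (r + k%:R) f + tail_level X n (2 * r + 1) (f - A f))%R.
pose E (y : R) := [set w | forall f, F f -> (empirical_mean Xs f w <=
    c f + 48 * expR 1 / Num.sqrt n%:R * y)%R].
have mE y : measurable (E y).
  exact: (measurable_empirical_le Xs cV
    (fun f => c f + 48 * expR 1 / Num.sqrt n%:R * y)%R FV finF).
(* The infimum defining [gamma_flat] need not be attained: the bound holds for
   every larger number, and continuity from above gives it for the infimum. *)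
have PE y : gamma_flat X calA l0 < y%:E -> (1 - 2 * expR (- r))%:E <= P (E y).
  move=> /ereal_inf_lt[_ [As adm <-] /ltW Hy].
  apply: (chaining_prob cV iidX n0 FV finF FA r2 Acon cardA adm) => a Aa.
  by apply: le_trans Hy; apply: ereal_sup_ubound; exists a.
have r1 : (1 <= r + k%:R)%R by have := ler0n R k; lra.
have r1' : (1 <= 2 * r + 1)%R by lra.
(* Both norms are finite, so the left-hand side is a real number. *)
have eqE f w (x : \bar R) : F f ->
    ((empirical_mean Xs f w)%:E
       - (4 * expR 1 * Num.sqrt ((r + k%:R) / n%:R))%R%:E
         * psi2_norm X (r + k%:R)%R f
       - (4 * expR 1 * Num.sqrt ((2 * r + 1) / n%:R))%R%:E
         * psi2_norm X (2 * r + 1)%R (f - A f)%R <= x) =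
    ((empirical_mean Xs f w - c f)%:E <= x).
  move=> Ff; rewrite -(fineK (psi2_norm_fin_num cV (FV _ Ff) r1)).
  have Vsub := centered_sub cV (FV _ Ff) (FV _ (FA _ Ff)).
  rewrite -(fineK (psi2_norm_fin_num cV Vsub r1')).
  by rewrite -!EFinM -!EFinB /c /tail_level opprD addrA.
have : 0 <= gamma_flat X calA l0.
  by apply: gamma_flat_ge0; exists (0 - A 0)%R; exists 0%R.
move gE : (gamma_flat X calA l0) => gam; case: gam gE => [g gE _|_ _|_]; last first.
- by rewrite leNgt ltNy0.
(* At the value [+oo] the right-hand side is [+oo] and the event is the whole space. *)
- rewrite gt0_mulye ?lte_fin ?invr_gt0// gt0_muley ?lte_fin//.
  rewrite (_ : [set w | _] = setT); last first.
    by apply/seteqP; split => // w _ f Ff; exact: leey.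
  rewrite [X in _ <= X]probability_setT lee_fin lerBlDr lerDl.
  by rewrite mulr_ge0// expR_ge0.
rewrite (_ : [set w | _] = \bigcap_m E (g + m.+1%:R^-1)%R); last first.
  apply/seteqP; split => w.
    move=> H m _ f Ff; have := H f Ff; rewrite eqE// -!EFinM lee_fin lerBlDl.
    move=> /le_trans; apply; rewrite lerD2l mulrCA mulrC ler_wpM2l ?(ltW K0)//.
    by rewrite lerDl invr_ge0.
  move=> H f Ff; rewrite eqE// -!EFinM lee_fin mulrCA mulrC.
  move: K0 H; set K := (48 * expR 1 / Num.sqrt n%:R)%R => K0 H.
  (* If the bound failed by [e > 0], an index [m] with [K / (m + 1) < e] would contradict the bound
     at [g + 1 / (m + 1)]. *)
  rewrite leNgt; apply/negP; rewrite -subr_gt0; set e := (_ - K * g)%R => e0.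
  have /andP[_ Ke] := truncn_itv (ltW (divr_gt0 K0 e0)).
  have := H (Num.truncn (K / e)) I f Ff.
  have : (K * (Num.truncn (K / e)).+1%:R^-1 < e)%R.
    by rewrite ltr_pdivrMr// mulrC -ltr_pdivrMr.
  by rewrite -/K mulrDr; move: (K * _^-1)%R; rewrite /e => z; lra.
have ni : nonincreasing_seq (fun m => E (g + m.+1%:R^-1)%R).
  move=> m p mp; apply/subsetPset => w H f Ff; apply: le_trans (H f Ff) _.
  rewrite lerD2l ler_wpM2l ?(ltW K0)//.
  by rewrite lerD2l lef_pV2 ?posrE// ler_nat.
have mEm m : measurable (E (g + m.+1%:R^-1)%R) by exact: mE.
have finE : P (E (g + 1%:R^-1)%R) < +oo.
  by apply: le_lt_trans (probability_le1 P (mE _)) _; rewrite ltry.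
have cv := nonincreasing_cvg_mu (mu := P) finE mEm (bigcapT_measurable mEm) ni.
rewrite -(cvg_lim _ cv)//; apply: lime_ge; first by apply/cvg_ex; eexists; exact: cv.
by apply: nearW => m; apply: PE; rewrite gE lte_fin ltrDl invr_gt0 ltr0n.
Qed.
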